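(* Let $\sigma$ be any type and $d^r$ be a block. Then \[ s_\sigma^\otimes H_{d^r} = \sum_{\tau} \operatorname{sgn}_r^\otimes(\tau/\sigma)\, s^\otimes_\tau,\] where we sum over all types $\tau$ obtained from $\sigma$ as follows: for some partition $\lambda$ of $d$, $\tau|_k$ is obtained by adding an $r^{m_k(\lambda)}$-polyribbon to $\sigma|_k$ for all $k\geq 1$; and $\operatorname{sgn}_r^\otimes(\tau/\sigma) = \prod_{k\geq 1} \operatorname{sgn}_r((\tau|_k)/(\sigma|_k))$.
   Context: An integer partition is a finite (possibly empty) weakly decreasing sequence of positive integers; $m_k(\lambda)$ is the number of parts of $\lambda$ equal to $k$. A block is an ordered pair of positive integers written $d^m$ (degree $d$, multiplicity $m$). Blocks are ordered by $a^b\ge d^e$ iff $a>d$, or $a=d$ and $b\ge e$. A type is a finite (possibly empty) weakly decreasing sequence of blocks. For $k\ge1$, $\tau|_k$ denotes the integer partition formed by the multiplicities of the blocks of $\tau$ of degree $k$; the type $\tau$ is determined by $(\tau|_k)_{k\ge1}$. Variables: $x_{k,j}$ for $k,j\ge 1$, with $\deg x_{k,j}=k$; $\mathbf{x}_{k*}=(x_{k,1},x_{k,2},\dots)$. The algebra $\mathsf{P\Lambda}$ of polysymmetric functions consists of the formal series over $\mathbb{Q}$ of bounded degree in all the $x_{k,j}$ that, for each fixed $k$, are unchanged by any permutation of the variables $\mathbf{x}_{k*}$. Define $s^{\otimes}_\tau=\prod_{k\ge1}s_{\tau|_k}(\mathbf{x}_{k*})$, where $s_\lambda$ is the Schur symmetric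 function. $H_d$ is the sum of all distinct monomials of degree $d$ in the variables $x_{k,j}$ (with $\deg x_{k,j}=k$), and $H_{d^r}$ is obtained from $H_d$ by replacing every variable $x_{k,j}$ by $x_{k,j}^r$. The diagram $\mathrm{dg}(\mu)$ is the set of boxes $(i,j)$ with $1\le i\le\ell(\mu)$, $1\le j\le\mu_i$ (row $1$ at the top). For $\mathrm{dg}(\mu)\subseteq\mathrm{dg}(\nu)$, $\nu/\mu=\mathrm{dg}(\nu)\setminus\mathrm{dg}(\mu)$. It is an $r$-ribbon if it consists of $r$ boxes that can be labeled $b_1,\dots,b_r$ so that for $1<i\le r$, $b_i$ is one unit left of or one unit below $b_{i-1}$. If a ribbon $R$ has boxes in exactly $q$ different rows, $\operatorname{sgn}(R)=(-1)^{q-1}$, and $\mathrm{top}(R)$ is the least index of a row containing a box of $R$. A skew shape $\lambda/\mu$ is an $r^n$-polyribbon ($n\ge0$) if there exist partitions $\mu=\gamma_{(0)}\subseteq\gamma_{(1)}\subseteq\cdots\subseteq\gamma_{(n)}=\lambda$ such that $\gamma_{(i)}/\gamma_{(i-1)}$ is an $r$-ribbon for $1\le i\le n$ and $\mathrm{top}(\gamma_{(i)}/\gamma_{(i-1)})\ge\mathrm{top}(\gamma_{(i+1)}/\gamma_{(i)})$ for $1\le i\le n-1$ (such a list is unique if it exists; for $n=0$ the shape is empty). Its sign is $\operatorname{sgn}_r(\lambda/\mu)=\prod_{i=1}^n\operatorname{sgn}(\gamma_{(i)}/\gamma_{(i-1)})$. ''Adding an $r^n$-polyribbon to $\mu$ to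 give $\lambda$'' means $\lambda/\mu$ is an $r^n$-polyribbon. *)

(* Defs.v *)
From HB Require Import structures.
From mathcomp Require Import all_boot all_order all_algebra.
From mathcomp Require Import finmap multiset.
From mathcomp Require Import boolp classical_sets functions cardinality fsbigop.

Set Implicit Arguments.
Unset Strict Implicit.
Unset Printing Implicit Defensive.

Import Order.TTheory GRing.Theory Num.Theory.

Local Open Scope classical_set_scope.
Local Open Scope ring_scope.

(* The pair (a, b) encodes the variable x_{a+1,b+1}, so that [nat * nat] is in
   bijection with the variables x_{k,j}, k, j >= 1. *)
Notation var := (nat * nat)%type (only parsing).

Definition xvar (k j : nat) : var := (k.-1, j.-1).
Definition vdeg (v : var) : nat := v.1.+1.

(* A monomial is the finite multiset of its variables; `+` is the product. *)
Notation monom := {mset var}%mset (only parsing).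

Definition mdeg (m : monom) : nat := (\sum_(v <- finsupp m) vdeg v * m v)%N.

(* The substitution of x_{k,j} ^ r for every x_{k,j} in a monomial. *)
Definition mpow (r : nat) (m : monom) : monom :=
  [fsfun x in finsupp m => (r * m x)%N].

(* All formal series over Q in the x_{k,j}; the algebra of polysymmetric
   functions is the subalgebra of those of bounded degree that are symmetric in
   (x_{k,j})_j for each k.  [f m] is the coefficient of m. *)
Definition series := monom -> rat.

HB.instance Definition _ := GRing.Lmodule.copy series (monom -> rat^o).

Definition splits (m : monom) : set (monom * monom) :=
  [set p | (p.1 `+` p.2)%mset = m].

Definition series_one : series := fun m => (m == mset0)%:R.

Definition series_mul (f g : series) : series :=
  fun m => \sum_(p \in splits m) f p.1 * g p.2.

Lemma finite_splits (m : monom) : finite_set (splits m).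
Proof.
pose F := {ffun finsupp m -> 'I_(size m).+1}.
pose toM (f : F) : monom :=
  [fsfun x in finsupp m => (if insub x is Some y then f y : nat else 0%N)].
have fin : finite_set [set: F * F] by exact: finite_finset.
apply: sub_finite_set (finite_image (fun u => (toM u.1, toM u.2)) fin).
have toMK (a b : monom) : (a `+` b)%mset = m -> exists f : F, toM f = a.
  move=> abm.
  have le x : (a x <= m x)%N by rewrite -abm msetE2 leq_addr.
  have lesize x : (m x <= size m)%N by rewrite -count_mem_mset count_size.
  exists [ffun y => inord (a (val y))].
  apply/fsfunP => x; rewrite fsfunE; case: ifPn => xm.
    by rewrite insubT ffunE /= inordK // ltnS (leq_trans (le x)).
  by move: (le x); rewrite (fsfun_dflt xm) leqn0 => /eqP.
move=> [a b] /= abm.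
have [f fa] := toMK _ _ abm.
have [|g gb] := toMK b a; first by rewrite msetDC.
by exists (f, g) => //=; rewrite fa gb.
Qed.

Definition fsplits (m : monom) : seq (monom * monom) := fset_set (splits m).

Lemma mem_fsplits m p : (p \in fsplits m) = ((p.1 `+` p.2)%mset == m).
Proof.
rewrite /fsplits in_fset_set; last exact: finite_splits.
by apply/idP/eqP; rewrite inE.
Qed.

Lemma uniq_fsplits m : uniq (fsplits m).
Proof. exact: fset_uniq. Qed.

Lemma series_mulE (f g : series) m :
  series_mul f g m = \sum_(p <- fsplits m) f p.1 * g p.2.
Proof. by rewrite /series_mul fsbig_finite //; exact: finite_splits. Qed.

Lemma series_mulC : commutative series_mul.
Proof.
move=> f g; apply/funext => m; rewrite !series_mulE.
have sw : perm_eq (fsplits m) [seq (p.2, p.1) | p <- fsplits m].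
  apply: uniq_perm; first exact: uniq_fsplits.
    by rewrite map_inj_uniq ?uniq_fsplits // => -[a b] [c d] [-> ->].
  move=> [a b]; rewrite mem_fsplits /=; apply/eqP/mapP.
    by move=> <-; exists (b, a) => //; rewrite mem_fsplits /= msetDC.
  by move=> [[c d]]; rewrite mem_fsplits => /eqP <- [-> ->]; rewrite msetDC.
rewrite (perm_big _ sw) big_map.
by apply: eq_bigr => p _; rewrite mulrC.
Qed.

Lemma series_mulA : associative series_mul.
Proof.
move=> f g h; apply/funext => m; rewrite !series_mulE.
pose L := [seq (p.1, q.1, q.2) | p <- fsplits m, q <- fsplits p.2].
pose R := [seq (q.1, q.2, p.2) | p <- fsplits m, q <- fsplits p.1].
have LR : perm_eq L R.
  apply: uniq_perm.
  - apply: allpairs_uniq_dep; first exact: uniq_fsplits.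
      by move=> p _; exact: uniq_fsplits.
    move=> u v /allpairsPdep[[a b] [[c d] [_ + ->]]].
    rewrite mem_fsplits /= => /eqP <-.
    move=> /allpairsPdep[[a' b'] [[c' d'] [_ + ->]]].
    by rewrite mem_fsplits /= => /eqP <- [-> -> ->].
  - apply: allpairs_uniq_dep; first exact: uniq_fsplits.
      by move=> p _; exact: uniq_fsplits.
    move=> u v /allpairsPdep[[a b] [[c d] [_ + ->]]].
    rewrite mem_fsplits /= => /eqP <-.
    move=> /allpairsPdep[[a' b'] [[c' d'] [_ + ->]]].
    by rewrite mem_fsplits /= => /eqP <- [-> -> ->].
  move=> [[a b] c]; rewrite /L /R; apply/idP/idP.
    move=> /allpairsPdep[[x y] [[z t] []]].
    rewrite !mem_fsplits /= => /eqP<- /eqP<- [-> -> ->].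
    apply/allpairsPdep; exists ((x `+` z)%mset, t), (x, z).
    by rewrite !mem_fsplits /= msetDA !eqxx.
  move=> /allpairsPdep[[x y] [[z t] []]].
  rewrite !mem_fsplits /= => /eqP<- /eqP<- [-> -> ->].
  apply/allpairsPdep; exists (z, (t `+` y)%mset), (t, y).
  by rewrite !mem_fsplits /= msetDA !eqxx.
transitivity (\sum_(u <- L) f u.1.1 * g u.1.2 * h u.2).
  rewrite big_allpairs_dep /=; apply: eq_bigr => p _.
  rewrite series_mulE big_distrr /=.
  by apply: eq_bigr => q _; rewrite mulrA.
rewrite (perm_big _ LR) big_allpairs_dep /=; apply: eq_bigr => p _.
by rewrite series_mulE big_distrl.
Qed.

Lemma series_mul1 : left_id series_one series_mul.
Proof.
move=> f; apply/funext => m; rewrite series_mulE.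
rewrite (bigD1_seq (mset0, m)) ?uniq_fsplits ?mem_fsplits /= ?mset0D //.
rewrite {1}/series_one eqxx mul1r big_seq_cond big1 ?addr0 // => -[a b].
rewrite mem_fsplits /= => /andP[/eqP abm ne].
rewrite /series_one; case: eqP => [a0|_]; last by rewrite mul0r.
by move: ne; rewrite -abm a0 mset0D eqxx.
Qed.

Lemma series_mulDl : left_distributive series_mul +%R.
Proof.
move=> f g h; apply/funext => m; rewrite [RHS]/= !series_mulE.
have -> : (series_mul f h + series_mul g h) m
  = series_mul f h m + series_mul g h m by [].
by rewrite !series_mulE -big_split /=; apply: eq_bigr => p _; rewrite -mulrDl.
Qed.

Lemma series_one_neq0 : series_one != 0.
Proof.
apply/eqP => /(congr1 (fun f : series => f mset0)).
by rewrite /series_one eqxx => /eqP; rewrite oner_eq0.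
Qed.

HB.instance Definition _ := GRing.Zmodule_isComNzRing.Build series
  series_mulA series_mulC series_mul1 series_mulDl series_one_neq0.

Lemma series_scaleAl (a : rat) (f g : series) : a *: (f * g) = (a *: f) * g.
Proof.
apply/funext => m.
have -> : (a *: (f * g)) m = a * series_mul f g m by [].
have -> : ((a *: f) * g) m = series_mul (a *: f) g m by [].
rewrite !series_mulE big_distrr /=; apply: eq_bigr => p _.
by rewrite mulrA.
Qed.

HB.instance Definition _ :=
  GRing.Lmodule_isLalgebra.Build rat series series_scaleAl.
HB.instance Definition _ := GRing.Lalgebra_isComAlgebra.Build rat series.

Definition is_part (la : seq nat) : bool :=
  sorted geq la && all (leq 1) la.

Definition block_ge (b c : nat * nat) : bool :=
  (b.1 > c.1)%N || (b.1 == c.1) && (b.2 >= c.2)%N.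

(* The block d^m is the pair (d, m). *)
Definition is_block (b : nat * nat) : bool := (0 < b.1)%N && (0 < b.2)%N.

Definition is_type (tau : seq (nat * nat)) : bool :=
  sorted block_ge tau && all is_block tau.

(* tau|_k *)
Definition restr (tau : seq (nat * nat)) (k : nat) : seq nat :=
  [seq b.2 | b <- tau & b.1 == k].

(* T is the list of the rows of a tableau with positive entries. *)
Definition ssyt (la : seq nat) (T : seq (seq nat)) : bool :=
  [&& shape T == la,
      all (all (leq 1)) T,
      all (sorted leq) T &
      sorted (fun R S => [forall j : 'I_(size S), nth 0 R j < nth 0 S j]%N) T].

Definition tab_monom (k : nat) (T : seq (seq nat)) : monom :=
  seq_mset [seq xvar k j | j <- flatten T].

(* s_la(x_{k,1}, x_{k,2}, ...), for k >= 1. *)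
Definition schur (k : nat) (la : seq nat) : series :=
  fun m => \sum_(T \in [set T | ssyt la T]) ((tab_monom k T == m)%:R : rat).

(* The factors with restr tau k = [::] are 1, so this infinite product has
   finite support; likewise for [sgn_tensor] below. *)
Definition schur_tensor (tau : seq (nat * nat)) : series :=
  \big[*%R/1]_(k \in [set k | (0 < k)%N]) schur k (restr tau k).

Definition hpoly (d : nat) : series := fun m => (mdeg m == d)%:R.

(* The series obtained from f by substituting x_{k,j} ^ r for every x_{k,j}. *)
Definition subst_pow (r : nat) (f : series) : series :=
  fun m => \sum_(n \in [set n | mpow r n = m]) f n.

Definition hblock (d r : nat) : series := subst_pow r (hpoly d).

(* Boxes are pairs (row, column), both numbered from 1. *)
Definition dg (mu : seq nat) : seq (nat * nat) :=
  [seq (i, j) | i <- iota 1 (size mu), j <- iota 1 (nth 0%N mu i.-1)].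

Definition skew_boxes (mu nu : seq nat) : seq (nat * nat) :=
  [seq b <- dg nu | b \notin dg mu].

Definition left_or_below (b c : nat * nat) : bool :=
  (c.1 == b.1) && (c.2.+1 == b.2) || (c.1 == b.1.+1) && (c.2 == b.2).

(* nu/mu is an r-ribbon; the orderings of the boxes of nu/mu are the labelings
   b_1, ..., b_r. *)
Definition ribbon (r : nat) (mu nu : seq nat) : bool :=
  [&& all [in dg nu] (dg mu),
      size (skew_boxes mu nu) == r &
      has (sorted left_or_below) (permutations (skew_boxes mu nu))].

Definition rows_of (R : seq (nat * nat)) : seq nat := undup [seq b.1 | b <- R].

Definition ribbon_sgn (R : seq (nat * nat)) : rat :=
  (-1) ^+ (size (rows_of R)).-1.

Definition ribbon_top (R : seq (nat * nat)) : nat :=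
  head 0%N (sort leq (rows_of R)).

(* gs = [gamma_(1); ...; gamma_(n)], with gamma_(0) = mu. *)
Definition polyribbon_chain (r : nat) (mu la : seq nat) (gs : seq (seq nat)) :
    bool :=
  [&& all is_part gs, last mu gs == la, path (ribbon r) mu gs &
      sorted geq [seq ribbon_top R | R <- pairmap skew_boxes mu gs]].

Definition polyribbon (r n : nat) (mu la : seq nat) : Prop :=
  exists2 gs, polyribbon_chain r mu la gs & size gs = n.

(* A chain from mu to la is unique if it exists, and [xget] returns it; the
   value is irrelevant when la/mu is not an r^n-polyribbon for any n. *)
Definition polyribbon_sgn (r : nat) (mu la : seq nat) : rat :=
  let gs := xget [::] [set gs | polyribbon_chain r mu la gs] in
  \prod_(R <- pairmap skew_boxes mu gs) ribbon_sgn R.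

Definition sgn_tensor (r : nat) (sigma tau : seq (nat * nat)) : rat :=
  \big[*%R/1]_(k \in [set k | (0 < k)%N])
     polyribbon_sgn r (restr sigma k) (restr tau k).

Definition obtained (d r : nat) (sigma tau : seq (nat * nat)) : Prop :=
  is_type tau /\
  exists la, [/\ is_part la, sumn la = d &
    forall k, (0 < k)%N ->
      polyribbon r (count_mem k la) (restr sigma k) (restr tau k)].

(* Main.v *)
Require Import Defs.
From mathcomp Require Import all_boot all_order all_algebra.
From mathcomp Require Import finmap multiset.
From mathcomp Require Import boolp classical_sets functions cardinality fsbigop.
From mathcomp Require Import zify.

(** The idea is to reduce the identity to one alphabet, and there to turn Schur
    functions into determinants, on which the sum over polyribbons is an expansion
    by multilinearity.

    Reduction to one alphabet. Sorting the variables of a monomial by degree shows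
    that [H_{d^r}] is the sum over partitions [la] of [d] of the products over [k]
    of [h_{m_k(la)}] in the [r]-th powers of the variables of degree [k]
    ([hset_split]). So it is enough to prove, for one alphabet,
      [s_mu * h_n(x_1^r, x_2^r, ...) = \sum_la sgn_r(la/mu) * s_la]
    over the [la] obtained from [mu] by adding an [r^n]-polyribbon ([schur_hset]);
    the products of these rules are collected by [schur_hset_degrees]. Each
    coefficient only involves finitely many variables, which leaves an identity
    between polynomials in [x_0, ..., x_(N-1)] with [N] large
    ([schur_poly_hpow]).

    Beads. Encode a partition by the positions [mu_i + N - i] of [N] beads
    ([beta]). Adding an [r]-ribbon means moving one bead from [v - r] to a vacant
    site [v] ([ribbon_bead_move], [bead_move_ribbon]): the contents of the boxes
    of the ribbon are, up to a shift, the sites [c] with [v - r < c <= v]. The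
    sign counts the beads jumped over, and the top row is determined by the number
    of beads above [v], so that the condition on the tops of a polyribbon says that
    the successive landing sites [v] increase ([sorted_mtops]). The landing sites,
    hence the chain, can be recovered from the first and last positions
    ([mvalid_inj]).

    Determinants. Replace each row of powers [x_i ^+ a] of the alternant
    [det (x_i ^+ (beta_j))] by [x_i ^+ a / (1 - t * x_i ^+ r)]; this multiplies it
    by the generating function of the [h_n] in the [x_i ^+ r]. The geometric
    series is built by allowing the landing sites [v] one after the other, and
    each of these steps adds to the row of a bead at [v - r] the variable [t]
    times the row of a bead at [v]. Expanding by linearity, a term is kept when
    the site [v] is vacant, is zero when it is occupied, and picks up the sign of
    the move when the rows are sorted ([row_det_jump], [alternant_hpow]). The terms
    are indexed by increasing lists of landing sites, that is, by polyribbons.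

    Back to Schur functions. The alternant of [beta] is the Schur polynomial times
    the Vandermonde determinant ([alternant_schur_poly]): both sides satisfy the
    same recursion on the number of variables, by elimination on one side
    and by removing the largest letter of a tableau on the other. The Vandermonde
    determinant can be cancelled because the differences of the variables are not
    zero divisors ([mono1_lreg]). *)

Set Implicit Arguments.
Unset Strict Implicit.
Unset Printing Implicit Defensive.

Import Order.TTheory GRing.Theory Num.Theory.

Local Open Scope classical_set_scope.
Local Open Scope ring_scope.

(** * Partitions as configurations of beads *)

Section Beads.
Local Open Scope nat_scope.

(** A partition with at most [N] parts is encoded by the strictly decreasing list
    of its parts shifted by [N - 1, ..., 1, 0]: the positions of [N] beads on a
    line of sites. *)
Definition beta (N : nat) (mu : seq nat) : seq nat :=
  mkseq (fun i => nth 0 mu i + (N - i.+1)) N.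

Lemma size_beta N mu : size (beta N mu) = N.
Proof. exact: size_mkseq. Qed.

Lemma nth_beta N mu i :
  i < N -> nth 0 (beta N mu) i = nth 0 mu i + (N - i.+1).
Proof. exact: nth_mkseq. Qed.

Lemma part_nth_geq mu i j :
  sorted geq mu -> i <= j -> nth 0 mu j <= nth 0 mu i.
Proof.
move=> smu ij; have [jl|jl] := ltnP j (size mu); last by rewrite nth_default.
have geq_trans : transitive geq by move=> a b c /= ba cb; exact: leq_trans cb ba.
exact: (sorted_leq_nth geq_trans leqnn 0 smu i j (leq_ltn_trans ij jl) jl ij).
Qed.

Lemma gtn_trans : transitive gtn.
Proof. by move=> a b c /=; lia. Qed.

Lemma sorted_gtn_uniq s : sorted gtn s -> uniq s.
Proof. by apply: sorted_uniq => [|a]; [exact: gtn_trans | rewrite /= ltnn]. Qed.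

Lemma sorted_gtn_mkseq (f : nat -> nat) n :
  (forall i, i.+1 < n -> f i.+1 < f i) -> sorted gtn (mkseq f n).
Proof.
move=> fdec; apply/(sortedP 0) => i; rewrite size_mkseq => iN.
by rewrite !nth_mkseq //=; [exact: fdec | lia].
Qed.

Lemma sorted_beta N mu : sorted geq mu -> sorted gtn (beta N mu).
Proof.
move=> smu; apply: sorted_gtn_mkseq => i iN.
by have := part_nth_geq smu (leqnSn i); lia.
Qed.

(** In a decreasing list the entries at least [c] form an initial segment, so
    counting them amounts to locating [c]. *)
Lemma sorted_nth_count s c i : sorted gtn s -> i < size s ->
  (c <= nth 0 s i) = (i < count (leq c) s).
Proof.
elim: s i => //= a s IH i pas; have ss := path_sorted pas.
have [ca|ac] := leqP c a; last first.
  have cs0 : count (leq c) s = 0.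
    apply/eqP; rewrite -leqn0 leqNgt -has_count; apply/hasPn => b bs.
    by have /allP/(_ b bs)/= := order_path_min gtn_trans pas; lia.
  case: i => [_|i /= ii]; first by rewrite cs0 /=; lia.
  by rewrite IH // cs0.
by case: i => [|i ii] /=; rewrite ?IH.
Qed.

Lemma count_leq_nth s i : sorted gtn s -> i < size s ->
  count (leq (nth 0 s i)) s = i.+1.
Proof.
move=> ss ii; have := sorted_nth_count (nth 0 s i) ss ii.
rewrite leqnn => /esym lti.
apply/eqP; rewrite eqn_leq lti andbT.
have [i1|i1] := ltnP i.+1 (size s); last first.
  by apply: leq_trans i1; rewrite count_size.
rewrite leqNgt -sorted_nth_count // -ltnNge.
exact: (sortedP 0 ss).
Qed.

Lemma count_leqS c s :
  count (leq c) s = count_mem c s + count (leq c.+1) s.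
Proof. by elim: s => //= a s ->; case: ltngtP; lia. Qed.

Lemma eq_sorted_gtn s1 s2 :
  sorted gtn s1 -> sorted gtn s2 -> s1 =i s2 -> s1 = s2.
Proof.
move=> h1 h2; apply: (irr_sorted_eq gtn_trans _ h1 h2) => a.
by rewrite /= ltnn.
Qed.

(** * Ribbons are bead moves *)

Lemma mem_dg mu b :
  (b \in dg mu) = (0 < b.1) && (0 < b.2 <= nth 0 mu b.1.-1).
Proof.
case: b => i j /=; apply/allpairsPdep/idP.
  move=> [i' [j' []]]; rewrite !mem_iota => hi hj [-> ->]; lia.
move=> h; exists i, j; split=> //; rewrite !mem_iota; last by lia.
have [|ge] := ltnP i.-1 (size mu); first by lia.
by move: h; rewrite nth_default //; lia.
Qed.

Lemma uniq_dg mu : uniq (dg mu).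
Proof.
apply: allpairs_uniq_dep => [|i _|]; rewrite ?iota_uniq //.
by move=> [a b] [c d] _ _ /= [-> ->].
Qed.

Lemma dg_sub mu nu :
  reflect (forall i, nth 0 mu i <= nth 0 nu i) (all [in dg nu] (dg mu)).
Proof.
apply: (iffP allP) => [h i|h b].
  case E: (nth 0 mu i) => [//|m].
  by have := h (i.+1, m.+1); rewrite /= !mem_dg /= E leqnn => /(_ isT).
by rewrite /= !mem_dg; move: (h b.1.-1); lia.
Qed.

Lemma mem_skew mu nu b : (b \in skew_boxes mu nu) =
  (0 < b.1) && (nth 0 mu b.1.-1 < b.2 <= nth 0 nu b.1.-1).
Proof. by rewrite mem_filter !mem_dg; case: (b.1); lia. Qed.

Lemma uniq_skew mu nu : uniq (skew_boxes mu nu).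
Proof. by rewrite filter_uniq ?uniq_dg. Qed.

(** The content of a box, shifted so that the last box of a row carries the
    position of the bead of that row. Adding boxes to a row thus sweeps the sites
    crossed by its bead. *)
Definition bval (N : nat) (b : nat * nat) : nat := b.2 + (N - b.1).

Lemma count_shift_iota k n c :
  count (fun j => j + k == c) (iota 1 n) = (k < c <= n + k).
Proof.
elim: n => [|n IH]; first by rewrite /=; lia.
by rewrite -[n.+1]addn1 iotaD count_cat IH /=; lia.
Qed.

(** The sum counts the beads of the empty partition at or above [c]. *)
Lemma count_bval_dg N mu (c : nat) : size mu <= N ->
  count_mem c (map (bval N) (dg mu)) + \sum_(i < N) (c <= N - i.+1)
  = count (leq c) (beta N mu).
Proof.
move=> muN; rewrite count_map /dg count_flatten -map_comp sumn_map.
have iotaE n : iota 0 n = index_iota 0 n by rewrite /index_iota subn0.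
rewrite [iota 1 (size mu)](iotaDl 1 0) big_map iotaE.
under eq_bigr => i _.
  rewrite /= count_map /bval /=.
  have -> : count (preim (pair (1 + i)) (preim (fun b => b.2 + (N - b.1)) (pred1 c)))
      (iota 1 (nth 0 mu i)) = (N - i.+1 < c <= nth 0 mu i + (N - i.+1)).
    by rewrite -count_shift_iota; apply: eq_count.
  over.
rewrite (big_nat_widen _ _ _ _ _ muN) big_mkcond /= big_mkord -big_split /=.
rewrite /beta /mkseq count_map -sum1_count iotaE.
rewrite big_mkord [RHS]big_mkcond /=; apply: eq_bigr => i _.
by case: ltnP => im; rewrite ?(nth_default _ im); case: ifP; lia.
Qed.

Lemma count_bval_skew N mu nu (c : nat) : size mu <= N -> size nu <= N ->
  (forall i, nth 0 mu i <= nth 0 nu i) ->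
  count (leq c) (beta N nu) =
  count (leq c) (beta N mu) + count_mem c (map (bval N) (skew_boxes mu nu)).
Proof.
move=> muN nuN le; rewrite -!count_bval_dg //.
have -> : count_mem c (map (bval N) (dg nu)) =
    count_mem c (map (bval N) (dg mu ++ skew_boxes mu nu)).
  apply/permP/perm_map/uniq_perm; rewrite ?uniq_dg //.
    rewrite cat_uniq uniq_dg uniq_skew andbT /=; apply/hasPn => b.
    by rewrite /= mem_filter => /andP[].
  by move=> b; rewrite mem_cat mem_skew !mem_dg; have := le b.1.-1; lia.
by rewrite map_cat count_cat; lia.
Qed.

Lemma count_mem_path_pred (v : nat) (t : seq nat) (c : nat) :
  path (fun a b => a == b.+1) v t ->
  size t <= v /\ count_mem c (v :: t) = (v - size t <= c <= v).
Proof.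
elim: t v => [|y t IH] v /=.
  by move=> _; split=> //; rewrite subn0 addn0 eqn_leq andbC.
move=> /andP[/eqP -> /IH [h1 /= h2]]; split; first by lia.
by rewrite h2; lia.
Qed.

(** The bead at [v - r] jumps to the site [v]. When [l] and [l'] are duplicate-free
    and [r > 0], this forces [v - r] to be occupied in [l] and [v] to be vacant. *)
Definition bead_move (r v : nat) (l l' : seq nat) : bool :=
  (r <= v) && perm_eq (v - r :: l') (v :: l).

Lemma bead_move_count r v l l' c : 0 < r -> bead_move r v l l' ->
  count (leq c) l' = count (leq c) l + (v - r < c <= v).
Proof. by move=> r0 /andP[rv /permP/(_ (leq c)) /=]; lia. Qed.

(** Along the path of boxes of a ribbon the content drops by one at each step, so
    the contents fill an interval [v - r < c <= v] without repetition. Hence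
    passing to the larger partition adds one to the number of beads at or above
    [c] exactly for these [c], which says that [v - r] was replaced by [v]. *)
Lemma ribbon_bead_move N r mu nu : 0 < r -> size mu <= N -> size nu <= N ->
  ribbon r mu nu -> exists v, bead_move r v (beta N mu) (beta N nu).
Proof.
move=> r0 muN nuN /and3P[/dg_sub le /eqP szr /hasP[s]].
rewrite mem_permutations => ps srt.
have memN b : b \in s -> (0 < b.1 <= N) && (0 < b.2).
  rewrite (perm_mem ps) mem_skew => h.
  have [|ge] := ltnP b.1.-1 (size nu); first by lia.
  by rewrite (nth_default _ ge) in h; lia.
have sz : size s = r by rewrite (perm_size ps).
have pmap := permP (perm_map (bval N) ps).
case: s => [|b s] in ps srt memN sz pmap *; first by move: sz r0 => <-.
have pth : path (fun a b => a == b.+1) (bval N b) (map (bval N) s).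
  rewrite path_map.
  have /allP al : {in b :: s, forall a, (0 < a.1 <= N) && (0 < a.2)} by [].
  apply: (sub_in_path _ al srt) => -[i j] [i' j'].
  by rewrite /left_or_below /bval /in_mem /=; lia.
have cnt c := (count_mem_path_pred c pth).2.
have [ltr _] := count_mem_path_pred 0 pth.
set v := bval N b; move: ltr cnt; rewrite size_map -/v => ltr cnt.
(* contents of boxes are positive, so [v - r] does not truncate *)
have lev : r <= v.
  rewrite leqNgt; apply/negP => vr; have := cnt 0.
  rewrite (_ : v - size s <= 0 <= v); last by move: sz; rewrite /=; lia.
  rewrite -[RHS]/1 => c1.
  have : has (pred1 0) (map (bval N) (b :: s)) 
    by rewrite has_count -[map _ _]/(v :: _) c1.
  by rewrite has_map => /hasP[a /memN]; rewrite /= /bval; lia.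
exists v; rewrite /bead_move lev /=; apply/allP => c _ /=.
have := count_bval_skew c muN nuN le; have := count_bval_skew c.+1 muN nuN le.
rewrite -!pmap /= -/v.
have := cnt c; have := cnt c.+1; rewrite /= -/v => -> ->.
rewrite !(count_leqS c); move: sz => /=; lia.
Qed.

(** Conversely, a bead move adds to the diagram exactly one box of each value
    [c] in [v - r < c <= v], in the row after those of the beads at or above [c];
    listed by decreasing value these boxes form a path. *)
Definition ribbon_box (N : nat) (l : seq nat) (c : nat) : nat * nat :=
  ((count (leq c) l).+1, c - (N - (count (leq c) l).+1)).

Section Move.
Variables (N r v : nat) (mu nu : seq nat).
Hypotheses (r0 : 0 < r) (smu : sorted geq mu) (snu : sorted geq nu).
Hypotheses (muN : size mu <= N) (nuN : size nu <= N).
Hypothesis mv : bead_move r v (beta N mu) (beta N nu).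
Let l := beta N mu.

Lemma bead_move_sub i : nth 0 mu i <= nth 0 nu i.
Proof.
have [iN|iN] := ltnP i N; last by rewrite nth_default //; lia.
have sb := sorted_beta N smu; have sb' := sorted_beta N snu.
have : nth 0 l i <= nth 0 (beta N nu) i.
  rewrite sorted_nth_count ?size_beta // (bead_move_count _ r0 mv).
  by rewrite count_leq_nth ?size_beta //; lia.
by rewrite /l !nth_beta // leq_add2r.
Qed.

Lemma mem_skew_move b : (b \in skew_boxes mu nu) =
  [&& 0 < b.1 <= N, v - r < bval N b <= v & b.1 == (count (leq (bval N b)) l).+1].
Proof.
rewrite mem_skew; case: b => i j /=.
have [h|h] := boolP (0 < i <= N); last first.
  apply/negbTE/negP => /andP[i0].
  by rewrite [nth 0 nu _]nth_default; lia.
have sb := sorted_beta N smu; have sb' := sorted_beta N snu.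
have iN : i.-1 < N by lia.
have := sorted_nth_count (bval N (i, j)) sb.
have := sorted_nth_count (bval N (i, j)) sb'.
rewrite !size_beta => /(_ _ iN) e1 /(_ _ iN); move: e1.
rewrite (bead_move_count _ r0 mv) -/l !nth_beta // /bval /=; lia.
Qed.

Lemma bead_move_vacant : v \notin l.
Proof.
have /andP[rv /permP/(_ (pred1 v))] := mv.
have := count_uniq_mem v (sorted_gtn_uniq (sorted_beta N snu)).
rewrite -/l /= eqxx => -> e; apply/count_memPn; move: e.
have -> : (v - r == v) = false by lia.
by case: (v \in _) => // -[].
Qed.

Lemma bead_move_occupied : v - r \in l.
Proof.
have /andP[rv /perm_mem/(_ (v - r))] := mv.
by rewrite !inE eqxx /= -/l; lia.
Qed.

Lemma ribbon_box_row c : v - r < c -> count (leq c) l < N.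
Proof.
move=> cr; rewrite -(size_beta N mu) ltn_neqAle count_size andbT -all_count.
by apply/negP => /allP/(_ _ bead_move_occupied)/=; lia.
Qed.

Lemma ribbon_boxK c : v - r < c -> bval N (ribbon_box N l c) = c.
Proof.
move=> cr; have iN := ribbon_box_row cr; rewrite /bval /=.
have := sorted_nth_count c (sorted_beta N smu); rewrite size_beta => /(_ _ iN).
by rewrite -/l ltnn nth_beta //; lia.
Qed.

Lemma skew_boxes_move :
  perm_eq (skew_boxes mu nu) [seq ribbon_box N l (v - i) | i <- iota 0 r].
Proof.
have /andP[rv _] := mv.
have inj : {in iota 0 r, cancel (fun i => ribbon_box N l (v - i))
                                (fun b => v - bval N b)}.
  by move=> i; rewrite mem_iota => ir; rewrite ribbon_boxK; lia.
apply: uniq_perm; first exact: uniq_skew.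
  rewrite map_inj_in_uniq ?iota_uniq // => i j hi hj e.
  by rewrite -(inj i hi) -(inj j hj) e.
move=> b; rewrite mem_skew_move; apply/and3P/mapP.
  move=> [b1 bv /eqP b1E]; exists (v - bval N b); first by rewrite mem_iota; lia.
  rewrite subKn; last by lia.
  by case: b b1 bv b1E => i j /= b1 bv b1E; rewrite /ribbon_box -b1E /bval /= addnK.
move=> [i]; rewrite mem_iota => ir ->; rewrite ribbon_boxK; last by lia.
by split; rewrite //=; [apply: ribbon_box_row|]; lia.
Qed.

Lemma bead_move_ribbon : ribbon r mu nu.
Proof.
have /andP[rv _] := mv.
apply/and3P; split; first by apply/dg_sub => i; exact: bead_move_sub.
  by rewrite (perm_size skew_boxes_move) size_map size_iota.
apply/hasP; exists [seq ribbon_box N l (v - i) | i <- iota 0 r].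
  by rewrite mem_permutations perm_sym skew_boxes_move.
rewrite -/(mkseq _ _); apply/(sortedP (0, 0)) => i; rewrite size_mkseq => ir.
rewrite !nth_mkseq //; last by lia.
have vi : v - i = (v - i.+1).+1 by lia.
have := ribbon_boxK (c := v - i); have := ribbon_boxK (c := v - i.+1).
have := ribbon_box_row (c := v - i); have := ribbon_box_row (c := v - i.+1).
have := count_leqS (v - i.+1) l; rewrite -vi /left_or_below /bval /=.
have := count_uniq_mem (v - i.+1) (sorted_gtn_uniq (sorted_beta N smu)); rewrite -/l.
by case: (_ \in l) => -> ->; move: (count (leq (v - i)) l) => k /=; lia.
Qed.

(** The ribbon starts in the row of the moved bead after the move and has one more
    row for each bead jumped over. *)
Lemma rows_of_move : perm_eq (rows_of (skew_boxes mu nu))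
  (iota (count (leq v) l).+1 (count (fun b => v - r < b < v) l).+1).
Proof.
have /andP[rv _] := mv; have sb := sorted_beta N smu.
have cnt : count (leq (v - r).+1) l =
    count (fun b => v - r < b < v) l + count (leq v) l.
  by elim: l => //= a s ->; lia.
apply: uniq_perm; rewrite ?undup_uniq ?iota_uniq // => k.
rewrite mem_undup (perm_mem (perm_map _ skew_boxes_move)) -map_comp mem_iota.
have mono c c' : c <= c' -> count (leq c') l <= count (leq c) l.
  by move=> cc; apply: sub_count => a /=; lia.
apply/mapP/idP => [[i]|hk].
  rewrite mem_iota /= => ir ->.
  have := mono (v - r).+1 (v - i); have := mono (v - i) v; lia.
have [kv|kv] := eqVneq k (count (leq v) l).+1.
  by exists 0; [rewrite mem_iota | rewrite /= subn0].
(* a row of the ribbon other than its first one contains the box whose value is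
   the bead of the row above *)
have k1N : k.-2 < N.
  by have := ribbon_box_row (c := (v - r).+1); lia.
have := sorted_nth_count v sb; have := sorted_nth_count (v - r).+1 sb.
have := count_leq_nth sb; rewrite !size_beta -/l => /(_ _ k1N) ck.
move=> /(_ _ k1N) ck1 /(_ _ k1N) ck2.
exists (v - nth 0 l k.-2); first by rewrite mem_iota; lia.
by rewrite /= subKn ?ck; lia.
Qed.

Lemma ribbon_sgn_move : ribbon_sgn (skew_boxes mu nu) =
  ((-1) ^+ count (fun b => (v - r < b < v)%N) l)%R.
Proof. by rewrite /ribbon_sgn (perm_size rows_of_move) size_iota. Qed.

Lemma ribbon_top_move : ribbon_top (skew_boxes mu nu) = (count (leq v) l).+1.
Proof.
rewrite /ribbon_top (_ : sort _ _ = iota (count (leq v) l).+1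
  (count (fun b => v - r < b < v) l).+1) //.
rewrite -[RHS](sorted_sort leq_trans) ?iota_sorted //.
by apply/perm_sortP; [exact: leq_total | exact: leq_trans | exact: anti_leq |
   exact: rows_of_move].
Qed.

End Move.
End Beads.

(** * Sequences of bead moves *)

Section Moves.
Local Open Scope nat_scope.

Lemma is_part_sorted mu : is_part mu -> sorted geq mu.
Proof. by case/andP. Qed.

Lemma part_nth_gt0 mu i : is_part mu -> (0 < nth 0 mu i) = (i < size mu).
Proof.
case/andP=> _ /(all_nthP 0) pos; have [im|im] := ltnP i (size mu).
  by rewrite pos.
by rewrite nth_default.
Qed.

Lemma eq_part mu nu : is_part mu -> is_part nu ->
  (forall i, nth 0 mu i = nth 0 nu i) -> mu = nu.
Proof.
move=> pm pn e.
have lt i : (i < size mu) = (i < size nu) by rewrite -!part_nth_gt0 // e.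
have sz : size mu = size nu by have := lt (size mu); have := lt (size nu); lia.
by apply: (eq_from_nth (x0 := 0)) => // i _.
Qed.

Lemma beta_inj N mu nu : is_part mu -> is_part nu ->
  size mu <= N -> size nu <= N -> beta N mu = beta N nu -> mu = nu.
Proof.
move=> pm pn mN nN e; apply: eq_part => // i.
have [iN|iN] := ltnP i N; last by rewrite !nth_default //; lia.
by have := nth_beta mu iN; rewrite e nth_beta //; lia.
Qed.

Definition unbeta (N : nat) (b : seq nat) : seq nat :=
  [seq x <- mkseq (fun i => nth 0 b i - (N - i.+1)) N | 0 < x].

Lemma nth_filter_gt0 s i : sorted geq s ->
  nth 0 [seq x <- s | 0 < x] i = nth 0 s i.
Proof.
elim: s i => [|[|a] s IH] i /= sas.
- by rewrite !nth_nil.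
- have s0 : all (pred1 0) s.
    apply: sub_all (order_path_min _ sas) => [x /=|x y z /=]; lia.
  rewrite -[RHS]/(nth 0 (0 :: s) i).
  rewrite (_ : [seq _ <- _ | _] = [::]).
    rewrite nth_nil; case: i => //= i.
    have [h|h] := ltnP i (size s); last by rewrite nth_default.
    by have /eqP -> := allP s0 _ (mem_nth 0 h).
  by apply/eqP; rewrite -size_eq0 size_filter -leqn0 leqNgt -has_count;
     apply/hasPn => x /(allP s0) /eqP ->.
- by case: i => //= i; rewrite IH //; exact: path_sorted sas.
Qed.

Section Unbeta.
Variables (N : nat) (b : seq nat).
Hypotheses (sb : sorted gtn b) (szb : size b = N).

Lemma sorted_gtn_lower i : i < N -> N - i.+1 <= nth 0 b i.
Proof.
move=> iN; have [k kE] : exists k, k = N - i.+1 by exists (N - i.+1).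
elim: k i iN kE => [|k IH] i iN kE; first by lia.
have := IH i.+1; have := sortedP 0 sb i; rewrite szb /=; lia.
Qed.

Let sorted_m : sorted geq (mkseq (fun i => nth 0 b i - (N - i.+1)) N).
Proof.
apply/(sortedP 0) => i; rewrite size_mkseq => iN.
rewrite !nth_mkseq //=; last by lia.
have := sortedP 0 sb i; rewrite szb /=; have := sorted_gtn_lower iN; lia.
Qed.

Lemma is_part_unbeta : is_part (unbeta N b).
Proof.
rewrite /is_part filter_all sorted_filter //.
by move=> x y z /=; lia.
Qed.

Lemma size_unbeta : size (unbeta N b) <= N.
Proof. by rewrite size_filter (leq_trans (count_size _ _)) // size_mkseq. Qed.

Lemma unbetaK : beta N (unbeta N b) = b.
Proof.
apply: (eq_from_nth (x0 := 0)); rewrite size_beta ?szb // => i iN.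
rewrite nth_beta // nth_filter_gt0 // nth_mkseq //.
by have := sorted_gtn_lower iN; lia.
Qed.

End Unbeta.

Lemma betaK N mu : is_part mu -> size mu <= N -> unbeta N (beta N mu) = mu.
Proof.
move=> pm mN; have sb := sorted_beta N (is_part_sorted pm).
apply: (@beta_inj N) => //; rewrite ?size_unbeta ?unbetaK ?size_beta //.
by apply: is_part_unbeta; rewrite ?size_beta.
Qed.

Definition movable (r : nat) (l : seq nat) (v : nat) : bool :=
  [&& r <= v, v - r \in l & v \notin l].

(** The list [l] with [v - r] replaced by [v], kept in decreasing order. The middle
    block consists of the beads jumped over. *)
Definition bmove (r : nat) (l : seq nat) (v : nat) : seq nat :=
  [seq b <- l | v < b] ++
  v :: [seq b <- l | v - r < b < v] ++ [seq b <- l | b < v - r].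

Section Bmove.
Variables (r : nat) (l : seq nat) (v : nat).
Hypotheses (r0 : 0 < r) (sl : sorted gtn l) (mv : movable r l v).

Lemma sorted_gtn_cat s1 s2 : sorted gtn s1 -> sorted gtn s2 ->
  {in s1 & s2, forall a b, b < a} -> sorted gtn (s1 ++ s2).
Proof.
rewrite !(sorted_pairwise gtn_trans) pairwise_cat => -> -> h.
by rewrite !andbT; apply/allrelP => a b; exact: h.
Qed.

Lemma bmove_decomp : l = [seq b <- l | v < b] ++
  [seq b <- l | v - r < b < v] ++ v - r :: [seq b <- l | b < v - r].
Proof.
have /and3P[rv oc vc] := mv.
have sf p : sorted gtn (filter p l) by exact: sorted_filter gtn_trans _ _ sl.
apply: eq_sorted_gtn => //.
  apply: sorted_gtn_cat => //; last first.
    by move=> a b; rewrite mem_cat inE !mem_filter; lia.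
  apply: sorted_gtn_cat => //; last first.
    by move=> a b; rewrite inE !mem_filter; lia.
  rewrite -cat1s; apply: sorted_gtn_cat => //.
  by move=> a b; rewrite inE mem_filter; lia.
move=> a; rewrite !mem_cat inE !mem_filter.
have [->|nv] := eqVneq a (v - r); first by rewrite oc !orbT.
have [->|nv'] := eqVneq a v; first by rewrite (negbTE vc) !andbF.
by case: (a \in l); lia.
Qed.

Lemma sorted_bmove : sorted gtn (bmove r l v).
Proof.
have /and3P[rv oc vc] := mv.
have sf p : sorted gtn (filter p l) by exact: sorted_filter gtn_trans _ _ sl.
apply: sorted_gtn_cat => //; last first.
  by move=> a b; rewrite inE mem_cat !mem_filter; lia.
rewrite -cat1s; apply: sorted_gtn_cat => //; last first.
  by move=> a b; rewrite inE mem_cat !mem_filter; lia.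
by apply: sorted_gtn_cat => // a b; rewrite !mem_filter; lia.
Qed.

Lemma bead_move_bmove : bead_move r v l (bmove r l v).
Proof.
have /and3P[rv oc vc] := mv; rewrite /bead_move rv /= [in X in perm_eq _ X]bmove_decomp.
rewrite /bmove -[v - r :: _]cat1s -[v :: _]cat1s -[v :: _ ++ _]cat1s.
rewrite -[v - r :: filter _ _]cat1s; apply/permP => p.
by rewrite !count_cat /=; lia.
Qed.

Lemma size_bmove : size (bmove r l v) = size l.
Proof. by have /andP[_ /perm_size[]] := bead_move_bmove. Qed.

Lemma bead_move_bmoveE l' : sorted gtn l' -> bead_move r v l l' ->
  l' = bmove r l v.
Proof.
move=> sl' /andP[_ p1]; have /andP[_ p2] := bead_move_bmove.
apply: eq_sorted_gtn => //; first exact: sorted_bmove.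
by apply: perm_mem; rewrite -(perm_cons (v - r)) (perm_trans p1) // perm_sym.
Qed.

Lemma mem_bmove : v \in bmove r l v.
Proof. by rewrite mem_cat mem_head orbT. Qed.

End Bmove.

Fixpoint mvalid (r : nat) (l vs : seq nat) : bool :=
  if vs is v :: vs' then movable r l v && mvalid r (bmove r l v) vs' else true.

(** The number of beads jumped over; each of them contributes a sign. *)
Fixpoint mheight (r : nat) (l vs : seq nat) : nat :=
  if vs is v :: vs' then
    count (fun b => v - r < b < v) l + mheight r (bmove r l v) vs'
  else 0.

(** Top rows of the ribbons added by the successive moves. *)
Fixpoint mtops (r : nat) (l vs : seq nat) : seq nat :=
  if vs is v :: vs' then
    (count (leq v) l).+1 :: mtops r (bmove r l v) vs'
  else [::].

(** Tops of ribbons move up exactly when landing sites increase. *)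
Lemma mtops_step r l v w : 0 < r -> sorted gtn l -> movable r l v ->
  movable r (bmove r l v) w ->
  (count (leq w) (bmove r l v) <= count (leq v) l) = (v < w).
Proof.
move=> r0 sl mv /and3P[_ _ nw].
have mono c c' s : c <= c' -> count (leq c') s <= count (leq c) s.
  by move=> cc; apply: sub_count => a /=; lia.
have cv := mem_bmove r l v.
have c1 := bead_move_count v.+1 r0 (bead_move_bmove r0 sl mv).
have c2 := count_leqS v l; have c3 := count_leqS v (bmove r l v).
have /and3P[_ _ nv] := mv; rewrite (count_memPn nv) in c2.
have : 0 < count_mem v (bmove r l v) by rewrite -has_count has_pred1.
have m1 := mono v.+1 w (bmove r l v); have m2 := mono w v (bmove r l v).
have : w != v by apply: contraNneq nw => ->.
by case: (ltngtP v w) m1 m2 => // vw m1 m2 _ h;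
   [have := m1 isT | have := m2 isT]; lia.
Qed.

Lemma sorted_mtops r l vs : 0 < r -> sorted gtn l -> mvalid r l vs ->
  sorted geq (mtops r l vs) = sorted ltn vs.
Proof.
move=> r0; elim: vs l => //= v [//|w vs] IH l sl /andP[mv mvs].
have := IH _ (sorted_bmove r0 sl mv) mvs => /= ->.
by have /= /andP[mw _] := mvs; rewrite ltnS mtops_step.
Qed.

Lemma mvalid_geq r l vs : mvalid r l vs -> all (leq r) vs.
Proof. by elim: vs l => //= v vs IH l /andP[/and3P[-> _ _] /IH]. Qed.

Lemma mvalid_sorted r l vs : 0 < r -> sorted gtn l -> mvalid r l vs ->
  sorted gtn (foldl (bmove r) l vs).
Proof.
by move=> r0; elim: vs l => //= v vs IH l sl /andP[mv /IH]; apply; exact: sorted_bmove.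
Qed.

Lemma mvalid_size r l vs : 0 < r -> sorted gtn l -> mvalid r l vs ->
  size (foldl (bmove r) l vs) = size l.
Proof.
move=> r0; elim: vs l => //= v vs IH l sl /andP[mv /IH ->]; last exact: sorted_bmove.
exact: size_bmove.
Qed.

(** Each move landing on [c + r] takes a bead away from [c], each move landing on
    [c] brings one. *)
Lemma mvalid_count r l vs c : 0 < r -> sorted gtn l -> mvalid r l vs ->
  count_mem (c + r) vs + count_mem c (foldl (bmove r) l vs) =
  count_mem c vs + count_mem c l.
Proof.
move=> r0; elim: vs l => //= v vs IH l sl /andP[mv /IH].
have /andP[rv /permP/(_ (pred1 c)) /=] := bead_move_bmove r0 sl mv.
by move=> e /(_ (sorted_bmove r0 sl mv)); lia.
Qed.

(** By [mvalid_count] the initial and final positions determine how often [c + r]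
    is landed on once this is known for [c]; sites below [r] are never landed
    on. *)
Lemma mvalid_inj r l vs vs' : 0 < r -> sorted gtn l ->
  mvalid r l vs -> mvalid r l vs' -> sorted ltn vs -> sorted ltn vs' ->
  foldl (bmove r) l vs = foldl (bmove r) l vs' -> vs = vs'.
Proof.
move=> r0 sl m m' s s' e.
apply: (irr_sorted_eq ltn_trans ltnn s s') => c.
suff : count_mem c vs = count_mem c vs'.
  by rewrite -!has_pred1 !has_count => ->.
elim/ltn_ind: c => c IH; have [rc|cr] := leqP r c.
  have := mvalid_count (c - r) r0 sl m; have := mvalid_count (c - r) r0 sl m'.
  by rewrite subnK // e; have := IH (c - r); lia.
rewrite !(count_memPn _) //; apply/negP => h.
  by have /allP/(_ c h) := mvalid_geq m'; lia.
by have /allP/(_ c h) := mvalid_geq m; lia.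
Qed.

Lemma mvalid_bound r l vs B : 0 < r -> sorted gtn l -> mvalid r l vs ->
  all (gtn B) l -> all (gtn (B + r * size vs)) vs.
Proof.
move=> r0; elim: vs l B => //= v vs IH l B sl /andP[mv mvs] bl.
have /and3P[rv oc _] := mv; have /= vB := allP bl _ oc.
apply/andP; split; first by lia.
have : all (gtn (B + r)) (bmove r l v).
  apply/allP => a; rewrite mem_cat inE mem_cat !mem_filter => h /=.
  have : (a == v) || (a \in l) by move: h; case: (a \in l); lia.
  by case/orP => [/eqP ->|/(allP bl) /=]; lia.
move=> /(IH _ _ (sorted_bmove r0 sl mv) mvs).
by apply: sub_all => a /=; lia.
Qed.

(** * Polyribbons are increasing lists of landing sites *)

Lemma ribbon_size r mu nu : is_part mu -> is_part nu -> ribbon r mu nu ->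
  size nu <= size mu + r.
Proof.
move=> pm pn /and3P[_ /eqP <- _]; rewrite -leq_subLR.
rewrite -[_ - _](size_iota (size mu).+1) -(size_map (fun i => (i, 1))).
apply: uniq_leq_size.
  by rewrite map_inj_uniq ?iota_uniq // => a b [].
move=> b /mapP[i]; rewrite mem_iota => ih ->; rewrite mem_skew /=.
have := part_nth_gt0 i.-1 pn; rewrite [nth 0 mu _]nth_default; lia.
Qed.

Lemma chain_moves N r mu gs : 0 < r -> is_part mu ->
  size mu + r * size gs <= N -> all is_part gs -> path (ribbon r) mu gs ->
  exists vs, let l := beta N mu in
    [/\ mvalid r l vs, map (beta N) gs = scanl (bmove r) l vs,
      [seq ribbon_top R | R <- pairmap skew_boxes mu gs] = mtops r l vs,
      (\prod_(R <- pairmap skew_boxes mu gs) ribbon_sgn R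
        = (-1) ^+ mheight r l vs)%R &
      all (fun g => size g <= N) gs].
Proof.
move=> r0; elim: gs mu => [|g gs IH] mu pm muN.
  by exists [::]; rewrite big_nil.
move=> /= /andP[pg pgs] /andP[rg rgs].
have sg := ribbon_size pm pg rg.
have smu := is_part_sorted pm; have snu := is_part_sorted pg.
have gN : size g <= N by move: muN; rewrite /=; lia.
have mN : size mu <= N by lia.
have [v mv] := ribbon_bead_move r0 mN gN rg.
have mvl : movable r (beta N mu) v.
  have /andP[rv _] := mv; rewrite /movable rv.
  by rewrite (bead_move_vacant r0 smu snu mN gN mv) (bead_move_occupied r0 smu snu mN gN mv).
have sb := sorted_beta N smu.
have gE := bead_move_bmoveE r0 sb mvl (sorted_beta N snu) mv.
have [|vs [h1 h2 h3 h4 h5]] := IH g pg _ pgs rgs; first by move: muN; rewrite /=; lia.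
exists (v :: vs); split=> /=; rewrite -?gE.
- by rewrite mvl.
- by rewrite h2.
- by rewrite h3 (ribbon_top_move r0 smu snu mN gN mv).
- by rewrite big_cons h4 (ribbon_sgn_move r0 smu snu mN gN mv) exprD.
- by rewrite gN.
Qed.

Lemma moves_chain N r mu vs : 0 < r -> is_part mu -> size mu <= N ->
  mvalid r (beta N mu) vs ->
  exists gs, [/\ all is_part gs, path (ribbon r) mu gs, size gs = size vs,
    [seq ribbon_top R | R <- pairmap skew_boxes mu gs] = mtops r (beta N mu) vs &
    last mu gs = unbeta N (foldl (bmove r) (beta N mu) vs)].
Proof.
move=> r0; elim: vs mu => [|v vs IH] mu pm mN /=.
  by exists [::]; rewrite betaK.
move=> /andP[mv mvs]; have smu := is_part_sorted pm.
have sb := sorted_beta N smu.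
have sb' := sorted_bmove r0 sb mv.
have szb' : size (bmove r (beta N mu) v) = N by rewrite size_bmove ?size_beta.
set g := unbeta N (bmove r (beta N mu) v).
have pg : is_part g by exact: is_part_unbeta.
have gN : size g <= N by exact: size_unbeta.
have gE : beta N g = bmove r (beta N mu) v by exact: unbetaK.
have bm : bead_move r v (beta N mu) (beta N g).
  by rewrite gE; exact: bead_move_bmove.
have sg := is_part_sorted pg.
rewrite -gE in mvs *; have [gs [h1 h2 h3 h4 h5]] := IH g pg gN mvs.
exists (g :: gs); split; rewrite /= ?pg ?h1 ?h2 ?h3 ?h4 ?andbT //.
  exact: bead_move_ribbon r0 smu sg mN gN bm.
by rewrite (ribbon_top_move r0 smu sg mN gN bm).
Qed.

Lemma last_scanl (T1 T2 : Type) (g : T1 -> T2 -> T1) x s :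
  last x (scanl g x s) = foldl g x s.
Proof. by elim: s x => /=. Qed.

Lemma polyribbon_chain_moves N r mu la gs : 0 < r -> is_part mu ->
  size mu + r * size gs <= N -> polyribbon_chain r mu la gs ->
  exists vs, let l := beta N mu in
    [/\ mvalid r l vs /\ sorted ltn vs, size vs = size gs,
      map (beta N) gs = scanl (bmove r) l vs,
      la = unbeta N (foldl (bmove r) l vs) &
      (\prod_(R <- pairmap skew_boxes mu gs) ribbon_sgn R
        = (-1) ^+ mheight r l vs)%R /\ all (fun g => size g <= N) gs].
Proof.
move=> r0 pm mN /and4P[pgs /eqP lastE pth tops].
have [vs [h1 h2 h3 h4 h5]] := chain_moves r0 pm mN pgs pth.
have sl := sorted_beta N (is_part_sorted pm).
exists vs; split=> //.
- by split=> //; rewrite -(sorted_mtops r0 sl h1) -h3.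
- by rewrite -(size_scanl (bmove r) (beta N mu)) -h2 size_map.
rewrite -last_scanl -h2 last_map lastE betaK // -lastE.
  by case/lastP: gs pgs {mN lastE pth tops h2 h3 h4 h5} => // gs g;
     rewrite all_rcons last_rcons => /andP[].
case/lastP: gs h5 mN {pgs lastE pth tops h2 h3 h4} => [_ /=|gs g]; first by lia.
by rewrite all_rcons last_rcons => /andP[].
Qed.

Lemma polyribbon_chain_uniq r mu la gs gs' : 0 < r -> is_part mu ->
  polyribbon_chain r mu la gs -> polyribbon_chain r mu la gs' -> gs = gs'.
Proof.
move=> r0 pm c c'; pose N := size mu + r * (size gs + size gs').
have mN : size mu + r * size gs <= N by rewrite /N; nia.
have mN' : size mu + r * size gs' <= N by rewrite /N; nia.
have [vs [[m s] _ e lE [_ b]]] := polyribbon_chain_moves r0 pm mN c.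
have [vs' [[m' s'] _ e' lE' [_ b']]] := polyribbon_chain_moves r0 pm mN' c'.
have sl := sorted_beta N (is_part_sorted pm).
have szf ws : mvalid r (beta N mu) ws ->
    beta N (unbeta N (foldl (bmove r) (beta N mu) ws)) = foldl (bmove r) (beta N mu) ws.
  move=> mw; rewrite unbetaK //; first exact: mvalid_sorted.
  by rewrite mvalid_size ?size_beta.
have vsE : vs = vs'.
  by apply: (mvalid_inj r0 sl m m' s s'); rewrite -(szf _ m) -(szf _ m') -lE -lE'.
have inj : {in [pred g | is_part g && (size g <= N)] &, injective (beta N)}.
  by move=> g g' /andP[p1 p2] /andP[p3 p4]; exact: beta_inj.
have /and4P[pg _ _ _] := c; have /and4P[pg' _ _ _] := c'.
apply: (inj_in_map inj); last by rewrite e e' vsE.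
  by apply/allP => g gin; apply/andP; rewrite (allP pg) ?(allP b).
by apply/allP => g gin; apply/andP; rewrite (allP pg') ?(allP b').
Qed.

Lemma polyribbon_sgnE r mu la gs : 0 < r -> is_part mu ->
  polyribbon_chain r mu la gs ->
  (polyribbon_sgn r mu la = \prod_(R <- pairmap skew_boxes mu gs) ribbon_sgn R)%R.
Proof.
move=> r0 pm c; rewrite /polyribbon_sgn (@xget_unique _ [::] _ gs c) // => g cg.
exact: polyribbon_chain_uniq cg c.
Qed.

End Moves.

(** * Determinants with a list of rows *)

Section RowDet.
Variables (R : comNzRingType) (n : nat).
Implicit Types (s : seq 'rV[R]_n) (f g : 'rV[R]_n).

Definition row_det s : R := \det (\matrix_(j < n) nth 0 s j).

Lemma row_det_linear s1 s2 a f g : (size s1 < n)%N ->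
  row_det (s1 ++ (a *: f + g) :: s2) =
  a * row_det (s1 ++ f :: s2) + row_det (s1 ++ g :: s2).
Proof.
move=> lt; rewrite -[row_det (s1 ++ g :: _)]mul1r.
pose i0 := Ordinal lt.
have nth_ne (h h' : 'rV[R]_n) (j : 'I_n) : j != i0 ->
    nth 0 (s1 ++ h :: s2) j = nth 0 (s1 ++ h' :: s2) j.
  rewrite -val_eqE /= => ji; rewrite !nth_cat; case: ltngtP ji => // ij _.
  by rewrite -[(j - size s1)%N]prednK ?subn_gt0.
have nth_eq (h : 'rV[R]_n) : nth 0 (s1 ++ h :: s2) i0 = h.
  by rewrite nth_cat ltnn subnn.
have row'E (h h' : 'rV[R]_n) : row' i0 (\matrix_(j < n) nth 0 (s1 ++ h :: s2) j) =
    row' i0 (\matrix_(j < n) nth 0 (s1 ++ h' :: s2) j).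
  apply/matrixP => i j; rewrite !mxE (nth_ne h h') //.
  by rewrite eq_sym neq_lift.
apply: (determinant_multilinear (i0 := i0)); rewrite ?rowK ?nth_eq //; last first.
  by rewrite scale1r.
Qed.

Lemma row_det_dup s i j : (i < j < n)%N -> nth 0 s i = nth 0 s j ->
  row_det s = 0.
Proof.
case/andP=> ij jn e.
apply: (determinant_alternate (i1 := Ordinal (ltn_trans ij jn)) (i2 := Ordinal jn)).
  by rewrite -val_eqE /= ltn_eqF.
by move=> k; rewrite !mxE /= e.
Qed.

Lemma row_det_swap s1 s2 f g : ((size s1).+1 < n)%N ->
  row_det (s1 ++ f :: g :: s2) = - row_det (s1 ++ g :: f :: s2).
Proof.
move=> lt; have lt' := ltnW lt.
have dup h : row_det (s1 ++ h :: h :: s2) = 0.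
  apply: (@row_det_dup _ (size s1) (size s1).+1); first by rewrite ltnSn.
  by rewrite !nth_cat ltnn ltnNge leqnSn /= subSnn subnn.
have lin h : row_det (s1 ++ h :: (f + g) :: s2) =
    row_det (s1 ++ h :: f :: s2) + row_det (s1 ++ h :: g :: s2).
  rewrite -!(cat_rcons h) -[f]scale1r row_det_linear ?size_rcons //.
  by rewrite mul1r scale1r.
have := dup (f + g); rewrite -[X in s1 ++ (X + _) :: _]scale1r row_det_linear //.
rewrite mul1r !lin !dup add0r addr0 => /eqP.
by rewrite addr_eq0 => /eqP.
Qed.

Lemma row_det_rot s1 s2 s3 f : (size (s1 ++ s2) < n)%N ->
  row_det (s1 ++ s2 ++ f :: s3) = (-1) ^+ size s2 * row_det (s1 ++ f :: s2 ++ s3).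
Proof.
elim/last_ind: s2 s3 => [|s2 g IH] s3 lt; first by rewrite expr0 mul1r.
rewrite cat_rcons catA row_det_swap; last by move: lt; rewrite !size_cat size_rcons addnS.
rewrite -catA IH; last by move: lt; rewrite !size_cat size_rcons addnS => /ltnW.
by rewrite size_rcons exprS mulN1r mulNr cat_rcons.
Qed.

End RowDet.

Section Alternant.
Variables (R : comNzRingType) (n : nat).

Definition pow_row (x : nat -> R) (a : nat) : 'rV[R]_n := \row_(i < n) x i ^+ a.

Definition alternant (x : nat -> R) (l : seq nat) : R :=
  row_det (map (pow_row x) l).

Lemma det_scale_col (A : 'M[R]_n) (d : 'I_n -> R) :
  \det (\matrix_(j, i) (A j i * d i)) = \det A * \prod_i d i.
Proof.
have -> : (\matrix_(j, i) (A j i * d i)) = A *m diag_mx (\row_i d i).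
  by apply/matrixP => i j; rewrite mul_mx_diag !mxE.
rewrite det_mulmx det_diag; congr (_ * _).
by apply: eq_bigr => i _; rewrite mxE.
Qed.

End Alternant.

Lemma det_coef_eq (R : comNzRingType) n d (A B : 'M[{poly R}]_n) :
  (forall i j k, (k <= d)%N -> (A i j)`_k = (B i j)`_k) ->
  forall k, (k <= d)%N -> (\det A)`_k = (\det B)`_k.
Proof.
move=> AB; pose e (p q : {poly R}) := forall k, (k <= d)%N -> p`_k = q`_k.
have eM p1 p2 q1 q2 : e p1 p2 -> e q1 q2 -> e (p1 * q1) (p2 * q2).
  move=> ep eq k kd; rewrite !coefM; apply: eq_bigr => i _.
  by rewrite ep ?eq // ?(leq_trans (leq_subr _ _)) // -ltnS (leq_trans (ltn_ord i)).
have eD p1 p2 q1 q2 : e p1 p2 -> e q1 q2 -> e (p1 + q1) (p2 + q2).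
  by move=> ep eq k kd; rewrite !coefD ep ?eq.
rewrite -/(e _ _); apply: (big_ind2 e) => [//|//|s _]; apply: (eM) => //.
by apply: (big_ind2 e) => [//|//|i _ k]; exact: AB.
Qed.

(** * Multiplying an alternant by a complete homogeneous polynomial *)

(** The admissible increasing lists of landing sites [w] with [v <= w < v + F],
    generated by deciding for each site in turn whether a bead lands there. *)
Fixpoint landings (r F v : nat) (l : seq nat) : seq (seq nat) :=
  if F is F'.+1 then
    landings r F' v.+1 l ++
    (if movable r l v then
       [seq v :: vs | vs <- landings r F' v.+1 (bmove r l v)] else [::])
  else [:: [::]].

Lemma mem_landings r F v l vs :
  (vs \in landings r F v l) =
  [&& mvalid r l vs, sorted ltn vs & all (fun w => v <= w < v + F)%N vs].
Proof.
elim: F v l vs => [|F IH] v l vs /=.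
  rewrite inE; case: vs => [|w vs] //=.
  by rewrite addn0 ltnNge andbN !andbF.
rewrite mem_cat IH; case: vs => [|w vs] /=.
  by [].
have cons_in (L : seq (seq nat)) u :
    (u :: vs \in [seq v :: s | s <- L]) = (u == v) && (vs \in L).
  apply/mapP/andP => [[s sL [-> ->]]|[/eqP -> h]]; first by [].
  by exists vs.
rewrite (fun_if (fun L => _ \in L)) cons_in in_nil IH (path_sortedE ltn_trans).
apply/orP/idP.
  case=> [/and3P[/andP[-> ->] /andP[-> ->] /andP[h1 h2]]|] /=.
    apply/andP; split; first by lia.
    by apply: sub_all h2 => a /=; lia.
  case: ifP => // mv /andP[/eqP -> /and3P[mvs -> h]]; rewrite mv mvs /= andbT.
  rewrite (sub_all _ h) /=; last by move=> a /=; lia.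
  apply/andP; split; first by lia.
  by apply: sub_all h => a /=; lia.
case/and3P=> /andP[mw mvs] /andP[h1 srt] /andP[h2 h3].
have h3' : all (fun a => v < a < v.+1 + F)%N vs.
  apply/allP => a av; have := allP h1 a av; have := allP h3 a av; rewrite /=; lia.
have [wv|wv] := eqVneq w v; [right|left].
  by rewrite -{1}wv mw /= -wv mvs srt /= wv.
by rewrite mw mvs h1 srt h3' /= andbT; lia.
Qed.

Lemma uniq_landings r F v l : uniq (landings r F v l).
Proof.
elim: F v l => //= F IH v l; rewrite cat_uniq IH /=.
case: ifP => //= mv; rewrite map_inj_uniq ?IH ?andbT => [|a b []//].
apply/hasPn => _ /mapP[s _ ->] /=; rewrite mem_landings /= ltnn.
by rewrite !andbF.
Qed.

Section Pieri.
Variables (R : comNzRingType) (n r : nat) (x : nat -> R).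
Hypothesis r0 : (0 < r)%N.
Let xP (i : nat) : {poly R} := (x i)%:P.

(** The generating function of the powers of [x] that a bead at [a] can reach with
    jumps of length [r] landing on sites [w] with [v <= w < v + F]; each jump is
    marked by the indeterminate. For large [F] it agrees with the geometric series
    [x ^+ a / (1 - x ^+ r * 'X)] up to high powers of ['X] ([jump_row_coef]). *)
Fixpoint jump_row (F v a : nat) : 'rV[{poly R}]_n :=
  if F is F'.+1 then
    if (a + r == v)%N then pow_row n xP a + 'X *: jump_row F' v.+1 v
    else jump_row F' v.+1 a
  else pow_row n xP a.

Lemma jump_row_id F v a : (a + r < v)%N -> jump_row F v a = pow_row n xP a.
Proof.
elim: F v => //= F IH v lt; rewrite ltn_eqF // IH //; exact: ltnW.
Qed.

Lemma jump_row_coef F v a (j : 'I_n) i : (v <= a + r)%N -> (a + r * i < v + F)%N ->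
  (jump_row F v a 0 j)`_i = x j ^+ (a + r * i).
Proof.
elim: F v a i => [|F IH] v a i va lt /=.
  have -> : i = 0%N by case: i lt => // i; rewrite mulnS; lia.
  by rewrite mxE muln0 addn0 -rmorphXn coefC.
case: eqP => e; last by rewrite IH //; lia.
rewrite !mxE coefD coefXM -rmorphXn coefC; case: i => [|i] /= in lt *.
  by rewrite muln0 addn0 addr0.
rewrite add0r IH; [|lia|by move: lt; rewrite mulnS; lia].
by rewrite mulnS addnA e.
Qed.

(** Allowing landings on [v] changes only the row of a bead at [v - r], to which it
    adds ['X] times the row of a bead at [v]. By linearity the determinant splits
    into a term where this bead stays and a term where it jumps; the latter
    vanishes when [v] is occupied, and otherwise sorting the rows produces the
    sign. *)
Lemma row_det_jump F v l : sorted gtn l -> size l = n ->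
  row_det (map (jump_row F v) l) =
  \sum_(vs <- landings r F v l)
    (-1) ^+ mheight r l vs * 'X^(size vs) * alternant n xP (foldl (bmove r) l vs).
Proof.
elim: F v l => [|F IH] v l sl szl.
  by rewrite big_seq1 expr0 !mul1r.
have ul := sorted_gtn_uniq sl.
have jumpE s : ((v - r)%N \notin s) || (v < r)%N ->
    map (jump_row F.+1 v) s = map (jump_row F v.+1) s.
  move=> h; apply/eq_in_map => a ain /=; case: eqP => // e.
  by move: h; rewrite -e addnK ain /=; lia.
have step A C : (r <= v)%N -> l = A ++ (v - r)%N :: C ->
    row_det (map (jump_row F.+1 v) l) = row_det (map (jump_row F v.+1) l) +
      'X * row_det (map (jump_row F v.+1) (A ++ v :: C)).
  move=> rv lE; have szAC : size (A ++ (v - r)%N :: C) = n by rewrite -lE.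
  have [nA nC] : (v - r)%N \notin A /\ (v - r)%N \notin C.
    by move: ul; rewrite lE uniq_catC /= mem_cat negb_or => /andP[/andP[]].
  rewrite {}lE.
  have jv : jump_row F.+1 v (v - r) =
      pow_row n xP (v - r) + 'X *: jump_row F v.+1 v by rewrite /= subnK ?eqxx.
  rewrite !map_cat !map_cons jv (jumpE A) ?nA // (jumpE C) ?nC //.
  rewrite addrC row_det_linear; last first.
    by rewrite size_map -szAC size_cat /= addnS ltnS leq_addr.
  by rewrite addrC (@jump_row_id F v.+1 (v - r)) // subnK.
rewrite [landings _ _ _ _]/= big_cat -IH //.
have [mv|nmv] := boolP (movable r l v).
  have lE := bmove_decomp r0 sl mv.
  have /and3P[rv _ _] := mv.
  rewrite catA in lE; rewrite (step _ _ rv lE).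
  congr (_ + _).
  rewrite big_map -catA !map_cat map_cons row_det_rot; last first.
    have := congr1 size lE; rewrite szl !size_cat !size_map /=; lia.
  rewrite -map_cat -map_cons -map_cat -/(bmove r l v).
  rewrite IH ?size_bmove ?sorted_bmove //.
  rewrite !big_distrr /=; apply: eq_bigr => vs _.
  rewrite size_map size_filter exprD exprS; set u := (-1) ^+ count _ _.
  by rewrite ['X * (u * _)]mulrCA -!mulrA; congr (u * _); rewrite mulrCA.
rewrite big_nil [RHS]addr0; have [lt|rv] := ltnP v r; first by rewrite jumpE // lt orbT.
have [oc|noc] := boolP ((v - r)%N \in l); last by rewrite jumpE ?noc.
have vl : v \in l by move: nmv; rewrite /movable rv oc negbK.
have [A [C lE]] : exists A C, l = A ++ (v - r)%N :: C.
  by case/splitPr: oc => A C; exists A, C.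
(* the site [v] is occupied: the jump produces two equal rows *)
rewrite (step A C) // [X in _ * X](_ : _ = 0) ?mulr0 ?addr0 //.
have vE : (v \in A) || (v \in C).
  move: vl; rewrite lE mem_cat inE; have -> : (v == v - r)%N = false by lia.
  by [].
have szAC : size (A ++ v :: C) = n by rewrite -szl lE !size_cat.
have nthm i : (i < n)%N -> nth 0 (map (jump_row F v.+1) (A ++ v :: C)) i =
    jump_row F v.+1 (nth 0%N (A ++ v :: C) i).
  by move=> lt; rewrite (nth_map 0%N) ?szAC.
have szA : (size A < n)%N by rewrite -szAC size_cat /= addnS ltnS leq_addr.
case/orP: vE => vin.
  have ia : (index v A < size A)%N by rewrite index_mem.
  apply: (@row_det_dup _ _ _ (index v A) (size A)); first by rewrite ia szA.
  rewrite !nthm //; last exact: ltn_trans szA.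
  by rewrite !nth_cat ia ltnn subnn /= nth_index.
have ic : (index v C < size C)%N by rewrite index_mem.
have lt : (size A + (index v C).+1 < n)%N.
  by rewrite -szAC size_cat /= ltn_add2l.
apply: (@row_det_dup _ _ _ (size A) (size A + (index v C).+1)).
  by rewrite lt andbT -[X in (X < _)%N]addn0 ltn_add2l.
rewrite !nthm // !nth_cat ltnn subnn /= ltnNge leq_addr /= addKn /=.
by rewrite nth_index.
Qed.

(** The complete homogeneous polynomial of degree [d] in the [x i ^+ r]. *)
Definition hpow (d : nat) : R :=
  (\prod_(i < n) \poly_(s < d.+1) x i ^+ (r * s))`_d.

(** With all jumps allowed each entry is that of the alternant times a geometric
    series depending only on the column, so the determinant factors. *)
Theorem alternant_hpow F d l : sorted gtn l -> size l = n ->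
  all (fun a => a + r * d < F)%N l ->
  alternant n x l * hpow d =
  \sum_(vs <- landings r F 0 l | size vs == d)
    (-1) ^+ mheight r l vs * alternant n x (foldl (bmove r) l vs).
Proof.
move=> sl szl bl.
have polyCE l' : alternant n xP l' = (alternant n x l')%:P.
  rewrite /alternant /row_det -det_map_mx; congr (\det _).
  apply/matrixP => i j; rewrite !mxE.
  have [h|h] := ltnP i (size l'); last by rewrite !nth_default ?size_map // !mxE.
  by rewrite !(nth_map 0%N) // !mxE rmorphXn.
transitivity ((row_det (map (jump_row F 0) l))`_d).
  pose B := \matrix_(j < n, i < n)
    ((\matrix_(j' < n, i' < n) (xP i' ^+ nth 0%N l j')) j i *
     \poly_(s < d.+1) x i ^+ (r * s)).
  transitivity ((\det B)`_d).
    rewrite /B det_scale_col (_ : \det _ = alternant n xP l).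
      by rewrite polyCE coefCM.
    congr (\det _); apply/matrixP => i j.
    by rewrite !mxE (nth_map 0%N) ?szl // mxE.
  apply: (@det_coef_eq _ _ d) => // j i k kd.
  rewrite !mxE (nth_map 0%N) ?szl // jump_row_coef //; last first.
    rewrite add0n; have /allP/(_ (nth 0%N l j)) := bl.
    rewrite mem_nth ?szl // => /(_ isT); apply: leq_ltn_trans.
    by rewrite leq_add2l leq_mul2l kd orbT.
  by rewrite -rmorphXn coefCM coef_poly ltnS kd exprD.
rewrite row_det_jump // coef_sum [RHS]big_mkcond /=.
apply: eq_bigr => vs _; rewrite polyCE.
have -> : (-1) ^+ mheight r l vs = ((-1) ^+ mheight r l vs)%:P :> {poly R}.
  by rewrite rmorphXn rmorphN1.
rewrite mulrAC -polyCM coefCM coefXn eq_sym.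
by case: eqP; rewrite ?mulr1 ?mulr0.
Qed.

End Pieri.

(** * Semistandard tableaux, built letter by letter *)

Section Tableaux.
Local Open Scope nat_scope.

(** The shapes left by removing the largest letter from a tableau of shape [la]. *)
Fixpoint interlacings (la : seq nat) : seq (seq nat) :=
  if la is a :: la' then
    if la' is b :: _ then
      [seq c :: nu | c <- iota b (a.+1 - b), nu <- interlacings la']
    else [:: [::]]
  else [::].

Implicit Types (la nu : seq nat) (T : seq (seq nat)).

Lemma mem_interlacings la nu :
  (nu \in interlacings la) = ((size nu).+1 == size la) &&
    all (fun i => nth 0 la i.+1 <= nth 0 nu i <= nth 0 la i) (iota 0 (size nu)).
Proof.
elim: la nu => [//|a [|b la] IH] nu.
  by rewrite /= inE; case: nu.
rewrite [interlacings _]/=; apply/allpairsP/andP.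
  move=> [[c nu'] [/=]]; rewrite mem_iota IH => hc /andP[/eqP sz al] ->.
  split; first by rewrite /= sz.
  rewrite [size _]/= [iota _ _]/= [all _ _]/= (iotaDl 1 0) all_map.
  by apply/andP; split; [lia | exact: al].
case: nu => [[//]|c nu] [/eqP[sz]]; rewrite [size _]/= [iota _ _]/= [all _ _]/=.
rewrite (iotaDl 1 0) all_map => /andP[hc al].
exists (c, nu); split=> //; rewrite /= ?mem_iota; first by lia.
by rewrite IH /= -sz eqxx.
Qed.

Lemma uniq_interlacings la : uniq (interlacings la).
Proof.
elim: la => [//|a [//|b la] IH].
rewrite [interlacings _]/=; apply: allpairs_uniq; rewrite ?iota_uniq //.
by move=> [c1 n1] [c2 n2] _ _ /= [-> ->].
Qed.

Definition extend_tab (k : nat) (la : seq nat) (T : seq (seq nat)) : seq (seq nat) :=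
  mkseq (fun j => nth [::] T j ++ nseq (nth 0 la j - size (nth [::] T j)) k)
        (size la).

(** Semistandard tableaux with entries at most [N], built by adding the entries
    equal to the largest letter along interlacing shapes. *)
Fixpoint tabs (N : nat) (la : seq nat) : seq (seq (seq nat)) :=
  if N is N'.+1 then
    [seq extend_tab N la T | nu <- interlacings la, T <- tabs N' nu]
  else [:: [::]].

Lemma size_extend_tab k la T : size (extend_tab k la T) = size la.
Proof. exact: size_mkseq. Qed.

Lemma nth_extend_tab k la T j : (j < size la) ->
  nth [::] (extend_tab k la T) j =
  nth [::] T j ++ nseq (nth 0 la j - size (nth [::] T j)) k.
Proof. exact: nth_mkseq. Qed.

Lemma nth_shape (T : seq (seq nat)) j : nth 0 (shape T) j = size (nth [::] T j).
Proof.
have [h|h] := ltnP j (size T); first by rewrite (nth_map [::]).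
by rewrite !nth_default ?size_map.
Qed.

Definition ssyt_le (N : nat) (la : seq nat) (T : seq (seq nat)) : bool :=
  ssyt la T && all (all (geq N)) T.

Definition row_lt (R S : seq nat) :=
  [forall j : 'I_(size S), nth 0 R j < nth 0 S j].

Lemma row_ltP R S : reflect (forall j, j < size S -> nth 0 R j < nth 0 S j) (row_lt R S).
Proof.
apply: (iffP forallP) => [h j js|h j]; last exact: h.
exact: (h (Ordinal js)).
Qed.

Lemma ssyt_leP N la T : reflect
  [/\ size T = size la,
      (forall j, size (nth [::] T j) = nth 0 la j),
      (forall j, all (fun e => 0 < e <= N) (nth [::] T j)),
      (forall j, sorted leq (nth [::] T j)) &
      (forall j, j.+1 < size la -> row_lt (nth [::] T j) (nth [::] T j.+1))]
  (ssyt_le N la T).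
Proof.
have nthT (P : seq nat -> bool) : P [::] -> reflect (forall j, P (nth [::] T j)) (all P T).
  move=> P0; apply: (iffP (all_nthP [::])) => [h j|h j _]; last exact: h.
  by have [lt|ge] := ltnP j (size T); [exact: h | rewrite nth_default].
apply: (iffP andP).
  case=> /and4P[/eqP sh /(nthT _ isT) h1 /(nthT _ isT) h2 /(sortedP [::]) h3].
  move=> /(nthT _ isT) h4.
  have szT : size T = size la by rewrite -sh size_map.
  split=> // j; first by rewrite -nth_shape sh.
    apply/allP => e ein; have := allP (h1 j) e ein; have := allP (h4 j) e ein.
    by rewrite /=; lia.
  by rewrite -szT; exact: h3.
case=> h1 h2 h3 h4 h5; split; last first.
  by apply/nthT => // j; apply: sub_all (h3 j) => e /=; lia.
apply/and4P; split.
- apply/eqP/(eq_from_nth (x0 := 0)); rewrite size_map // => j _.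
  by rewrite nth_shape.
- by apply/nthT => // j; apply: sub_all (h3 j) => e /=; lia.
- exact/nthT.
- by apply/(sortedP [::]) => j; rewrite h1; exact: h5.
Qed.

Lemma filter_lt_sorted k s : sorted leq s -> all (geq k) s ->
  s = [seq e <- s | e < k] ++ nseq (size s - size [seq e <- s | e < k]) k.
Proof.
elim: s => [//|a s IH] /= pas /andP[ak ask]; have ss := path_sorted pas.
case: ltnP => ka /=; first by rewrite subSS -IH.
have -> : a = k by lia.
have kall : all (pred1 k) s.
  apply/allP => e es; have /allP/(_ e es) := order_path_min leq_trans pas.
  by have := allP ask e es => /=; lia.
have -> : [seq e <- s | e < k] = [::].
  apply/eqP; rewrite -size_eq0 size_filter -leqn0 leqNgt -has_count.
  by apply/hasPn => e /(allP kall)/eqP ->; rewrite ltnn.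
by rewrite subn0 /=; congr (_ :: _); apply/all_pred1P.
Qed.

Lemma filter_lt_extend k s m : all (fun e => e < k) s ->
  [seq e <- s ++ nseq m k | e < k] = s.
Proof.
move=> /all_filterP sk; rewrite filter_cat sk (_ : filter _ (nseq _ _) = [::]).
  by rewrite cats0.
by elim: m => //= m ->; rewrite ltnn.
Qed.

Lemma sorted_cat_nseq k s m : sorted leq s -> all (geq k) s ->
  sorted leq (s ++ nseq m k).
Proof.
rewrite !(sorted_pairwise leq_trans) pairwise_cat => -> /allP sk /=.
apply/andP; split; first by apply/allrelP => a b /sk ak /nseqP[-> _].
by elim: m => //= m ->; rewrite andbT; apply/allP => b /nseqP[-> _].
Qed.

Lemma nth_interlacings la nu j : nu \in interlacings la ->
  (j < size nu) -> (nth 0 la j.+1 <= nth 0 nu j <= nth 0 la j).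
Proof.
by rewrite mem_interlacings => /andP[_ /allP h] jn; apply: h; rewrite mem_iota.
Qed.

Lemma size_interlacings la nu : nu \in interlacings la -> size la = (size nu).+1.
Proof. by rewrite mem_interlacings => /andP[/eqP]. Qed.

Lemma sorted_interlacings la nu : nu \in interlacings la -> sorted geq nu.
Proof.
move=> h; apply/(sortedP 0) => j jn /=.
by have := nth_interlacings h jn; have := nth_interlacings h (ltnW jn); lia.
Qed.

Lemma ssyt_le_extend N la nu T : nu \in interlacings la -> ssyt_le N nu T ->
  ssyt_le N.+1 la (extend_tab N.+1 la T).
Proof.
move=> nuin /ssyt_leP[h1 h2 h3 h4 h5]; have szla := size_interlacings nuin.
have nthE j : nth [::] (extend_tab N.+1 la T) j =
    nth [::] T j ++ nseq (nth 0 la j - nth 0 nu j) N.+1.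
  have [lt|ge] := ltnP j (size la); first by rewrite nth_extend_tab // h2.
  rewrite [LHS]nth_default ?size_extend_tab // [nth [::] T j]nth_default.
    by rewrite [nth 0 la j]nth_default.
  by rewrite h1; lia.
have nule j : (nth 0 nu j <= nth 0 la j).
  have [lt|ge] := ltnP j (size nu); last by rewrite nth_default.
  by have := nth_interlacings nuin lt; lia.
apply/ssyt_leP; split; first exact: size_extend_tab.
- by move=> j; rewrite nthE size_cat size_nseq h2 subnKC.
- move=> j; rewrite nthE all_cat; apply/andP; split.
    by apply: sub_all (h3 j) => e /=; lia.
  by apply/allP => e /nseqP[-> _]; rewrite leqnn.
- move=> j; rewrite nthE; apply: sorted_cat_nseq (h4 j) _.
  by apply: sub_all (h3 j) => e /=; lia.
- move=> j jl; rewrite !nthE; apply/row_ltP => c; rewrite size_cat size_nseq h2.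
  rewrite subnKC // => cl; have jn : (j < size nu) by lia.
  have := nth_interlacings nuin jn => hj.
  have cj : (c < nth 0 nu j) by lia.
  rewrite !nth_cat !h2 cj; have [cS|cS] := ltnP c (nth 0 nu j.+1).
    have jn1 : (j.+1 < size nu).
      by rewrite ltnNge; apply/negP => ge; rewrite nth_default in cS.
    by move/row_ltP: (h5 j jn1); apply; rewrite h2.
  rewrite nth_nseq ifT; last by lia.
  by have /(all_nthP 0)/(_ c) := h3 j; rewrite h2 => /(_ cj); lia.
Qed.

(** Entries increase down the columns, so those of row [j] exceed [j]. *)
Lemma ssyt_le_row N la T j : sorted geq la -> ssyt_le N la T ->
  all (leq j.+1) (nth [::] T j).
Proof.
move=> sla /ssyt_leP[h1 h2 h3 h4 h5].
elim: j => [|j IH].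
  by apply: sub_all (h3 0) => e /=; lia.
have [lt|ge] := ltnP j.+1 (size la); last by rewrite nth_default ?h1.
apply/(all_nthP 0) => c cl.
have /row_ltP/(_ c cl) := h5 j lt; have /(all_nthP 0)/(_ c) := IH.
have := part_nth_geq sla (leqnSn j); rewrite -!h2 => le.
by move=> /(_ (leq_trans cl le)); lia.
Qed.

(** Each row is its part below [N.+1] completed by entries [N.+1]. The remaining
    shape interlaces [la] because an entry of row [j] with an entry below it is at
    most [N]. *)
Lemma ssyt_le_restrict N la T : size la = N.+1 -> sorted geq la ->
  ssyt_le N.+1 la T ->
  exists2 nu, nu \in interlacings la & exists2 T', ssyt_le N nu T' &
    T = extend_tab N.+1 la T'.
Proof.
move=> szla sla ssT; have lastT := ssyt_le_row N sla ssT.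
have /ssyt_leP[h1 h2 h3 h4 h5] := ssT.
pose T' := [seq [seq e <- R | (e < N.+1)] | R <- take N T].
have szT' : size T' = N by rewrite size_map size_takel // h1 szla.
have nthT' j : nth [::] T' j = [seq e <- nth [::] T j | (e < N.+1)].
  have [lt|ge] := ltnP j N.
    by rewrite (nth_map [::]) ?nth_take // size_takel // h1 szla.
  rewrite nth_default ?szT' //; apply/esym/eqP.
  have [|gt] := ltnP N j; first by move=> lt; rewrite nth_default // h1 szla.
  have -> : j = N by lia.
  rewrite -size_eq0 size_filter -leqn0 leqNgt -has_count; apply/hasPn => e.
  by move/(allP lastT) => /=; lia.
have split j : nth [::] T j = nth [::] T' j ++
    nseq (nth 0 la j - size (nth [::] T' j)) N.+1.
  rewrite nthT' -h2; apply: filter_lt_sorted; first exact: h4.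
  by apply: sub_all (h3 j) => e /=; lia.
exists (shape T'); last first.
  exists T'; last first.
    apply: (eq_from_nth (x0 := [::])); rewrite ?size_extend_tab ?h1 // => j jl.
    by rewrite nth_extend_tab.
  apply/ssyt_leP; split=> //.
  - by rewrite [RHS]size_map.
  - by move=> j; rewrite nth_shape.
  - move=> j; rewrite nthT'; apply/allP => e; rewrite mem_filter => /andP[eN ein].
    by have := allP (h3 j) e ein; lia.
  - by move=> j; rewrite nthT'; apply: sorted_filter (h4 j); exact: leq_trans.
  move=> j; rewrite [size (shape _)]size_map szT' => jN; apply/row_ltP => c cl.
  have jl : (j.+1 < size la) by lia.
  have cl' : (c < size (nth [::] T j.+1)).
    by apply: leq_trans cl _; rewrite nthT' size_filter count_size.
  have Sc : nth 0 (nth [::] T j.+1) c = nth 0 (nth [::] T' j.+1) c.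
    by rewrite [in LHS]split nth_cat cl.
  have /row_ltP/(_ c cl') := h5 j jl; rewrite Sc => lt.
  have ltN : (nth 0 (nth [::] T' j.+1) c < N.+1).
    have : nth 0 (nth [::] T' j.+1) c \in nth [::] T' j.+1 by rewrite mem_nth.
    by rewrite {2}nthT' mem_filter => /andP[].
  move: lt; rewrite [in X in (X < _) -> _]split nth_cat.
  case: (ltnP c (size (nth [::] T' j))) => // cge.
  rewrite nth_nseq; case: ifP => ge; first by lia.
  (* the column would leave row [j] *)
  by have := part_nth_geq sla (leqnSn j); move: cl'; rewrite h2; lia.
rewrite mem_interlacings [size (shape _)]size_map szT' szla eqxx /=; apply/allP => j.
rewrite mem_iota add0n => /= jN; rewrite nth_shape.
apply/andP; split; last by rewrite nthT' size_filter -h2 count_size.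
have jl : (j.+1 < size la) by lia.
rewrite nthT' size_filter -h2; set m := size _.
have ml : (m <= size (nth [::] T j)) by rewrite /m !h2 part_nth_geq.
rewrite -[nth [::] T j](cat_take_drop m) count_cat.
apply: leq_trans (leq_addr _ _).
suff : all (fun e => e < N.+1) (take m (nth [::] T j)).
  by rewrite all_count => /eqP ->; rewrite size_takel.
apply/(all_nthP 0) => c; rewrite size_takel // => cm; rewrite nth_take //.
have /row_ltP/(_ c cm) := h5 j jl; have /(all_nthP 0)/(_ c cm) := h3 j.+1; lia.
Qed.

Lemma mem_tabs N la T : size la = N -> sorted geq la ->
  (T \in tabs N la) = ssyt_le N la T.
Proof.
elim: N la T => [|N IH] la T szla sla.
  case: la szla {sla} => // _; rewrite /= inE.
  apply/eqP/ssyt_leP => [->|[/= h _ _ _ _]]; last by case: T h.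
  by split=> // j; rewrite ?nth_nil.
rewrite [tabs _ _]/=; apply/allpairsPdep/idP.
  move=> [nu [T' [nuin]]]; have sznu := size_interlacings nuin.
  rewrite IH; [|by lia|exact: sorted_interlacings nuin].
  by move=> h ->; exact: ssyt_le_extend nuin h.
move/(ssyt_le_restrict szla sla) => [nu nuin [T' h ->]].
exists nu, T'; split=> //; rewrite IH //; last exact: sorted_interlacings nuin.
by have := size_interlacings nuin; lia.
Qed.

Lemma shape_tabs N nu T : size nu = N -> sorted geq nu -> T \in tabs N nu ->
  shape T = nu.
Proof. by move=> h1 h2; rewrite mem_tabs // => /andP[/and4P[/eqP]]. Qed.

Lemma uniq_tabs N la : size la = N -> sorted geq la -> uniq (tabs N la).
Proof.
elim: N la => [//|N IH] la szla sla; rewrite [tabs _ _]/=.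
have okP nu : nu \in interlacings la -> size nu = N /\ sorted geq nu.
  move=> nuin; split; last exact: sorted_interlacings nuin.
  by have := size_interlacings nuin; lia.
apply: allpairs_uniq_dep; first exact: uniq_interlacings.
  by move=> nu /okP[h1 h2]; exact: IH.
move=> u1 u2 /allpairsPdep[n1 [T1 [n1in T1in ->]]].
move=> /allpairsPdep[n2 [T2 [n2in T2in ->]]].
have [[s1 o1] [s2 o2]] := (okP _ n1in, okP _ n2in).
rewrite /= => e.
have TE nu T : nu \in interlacings la -> T \in tabs N nu ->
    T = mkseq (fun j => [seq x <- nth [::] (extend_tab N.+1 la T) j | x < N.+1]) N.
  move=> nuin Tin; have [s o] := okP _ nuin.
  move: Tin; rewrite mem_tabs // => /ssyt_leP[h1 h2 h3 _ _].
  apply: (eq_from_nth (x0 := [::])); rewrite ?size_mkseq h1 // s => j jN.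
  rewrite nth_mkseq // nth_extend_tab; last by rewrite szla; lia.
  rewrite filter_lt_extend //.
  by apply: sub_all (h3 j) => x /=; lia.
have eT : T1 = T2 by rewrite (TE _ _ n1in T1in) (TE _ _ n2in T2in) e.
by rewrite -(shape_tabs s1 o1 T1in) -(shape_tabs s2 o2 T2in) eT.
Qed.

End Tableaux.

(** * The bialternant formula *)

Section RowDetSum.
Variables (R : comNzRingType) (n : nat).

Lemma row_det_sum (I : Type) (r : seq I) (a : I -> R) (f : I -> 'rV[R]_n) s1 s2 :
  (size s1 < n)%N ->
  row_det (s1 ++ (\sum_(i <- r) a i *: f i) :: s2) =
  \sum_(i <- r) a i * row_det (s1 ++ f i :: s2).
Proof.
move=> lt; elim: r => [|i r IH]; last by rewrite !big_cons row_det_linear // IH.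
have := row_det_linear s2 1 0 0 lt; rewrite scale1r addr0 mul1r !big_nil => /eqP.
by rewrite -subr_eq0 opprD addNKr oppr_eq0 => /eqP.
Qed.

End RowDetSum.

Section Bialternant.
Variables (R : comNzRingType) (x : nat -> R).

Definition schur_poly (N : nat) (la : seq nat) : R :=
  \sum_(T <- tabs N la) \prod_(e <- flatten T) x e.-1.

(** The number of boxes of the horizontal strip between interlacing shapes; [nu]
    has one part less than [la]. *)
Definition strip_size (la nu : seq nat) : nat :=
  (\sum_(j < size nu) (nth 0 la j - nth 0 nu j) + last 0 la)%N.

Lemma prod_extend_tab N la nu T : nu \in interlacings la -> shape T = nu ->
  \prod_(e <- flatten (extend_tab N.+1 la T)) x e.-1 =
  x N ^+ strip_size la nu * \prod_(e <- flatten T) x e.-1.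
Proof.
move=> nuin shT; have szla := size_interlacings nuin.
have szT : size T = size nu by rewrite -shT size_map.
have iotaE k : iota 0 k = index_iota 0 k by rewrite /index_iota subn0.
have prod_nseq m : \prod_(e <- nseq m N.+1) x e.-1 = x N ^+ m.
  by rewrite big_nseq iter_mulr mulr1.
rewrite !big_flatten /= big_map szla iotaE big_mkord.
transitivity (\prod_(j < (size nu).+1) (\prod_(e <- nth [::] T j) x e.-1 *
    x N ^+ (nth 0%N la j - size (nth [::] T j)))).
  by apply: eq_bigr => j _; rewrite big_cat prod_nseq.
rewrite big_split /= mulrC; congr (_ * _).
  rewrite big_ord_recr /= [nth [::] T _]nth_default ?szT // subn0.
  rewrite /strip_size -nth_last szla exprD; congr (_ * _).
  rewrite (big_morph _ (exprD (x N)) (expr0 _)).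
  by apply: eq_bigr => j _; rewrite -nth_shape shT.
rewrite big_ord_recr /= [nth [::] T _]nth_default ?szT // big_nil mulr1.
by rewrite (big_nth [::]) szT big_mkord.
Qed.

Lemma schur_poly_branch N la : size la = N.+1 -> sorted geq la ->
  schur_poly N.+1 la =
  \sum_(nu <- interlacings la) x N ^+ strip_size la nu * schur_poly N nu.
Proof.
move=> szla sla; rewrite /schur_poly [tabs _ _]/= big_allpairs_dep.
rewrite big_seq [RHS]big_seq; apply: eq_bigr => nu nuin.
rewrite big_distrr big_seq [RHS]big_seq /=; apply: eq_bigr => T Tin.
apply: prod_extend_tab => //; apply: shape_tabs Tin.
  by have := size_interlacings nuin; lia.
exact: sorted_interlacings nuin.
Qed.

Lemma beta_cons a l :
  beta (size (a :: l)) (a :: l) = (a + size l)%N :: beta (size l) l.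
Proof.
rewrite /beta /mkseq /= subSS subn0; congr (_ :: _).
by rewrite (iotaDl 1 0) -map_comp; apply: eq_map => i /=; rewrite subSS.
Qed.

Section Branch.
Variable N : nat.
Local Notation row a := (pow_row N.+1 x a).
Let y := x N.
(** The monomial row of exponent [c] with the column of [x i] multiplied by
    [x i - x N]; it vanishes in the last column. *)
Let diff_row (c : nat) : 'rV[R]_N.+1 := row c.+1 - y *: row c.

Lemma diff_row_telescope b m k :
  row (b + k + m)%N - y ^+ m *: row (b + k)%N =
  \sum_(c <- iota b m) y ^+ (b + m - c.+1) *: diff_row (c + k).
Proof.
elim: m => [|m IH].
  by rewrite addn0 expr0 scale1r subrr big_nil.
have -> : iota b m.+1 = iota b m ++ [:: (b + m)%N] by rewrite -addn1 iotaD.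
rewrite big_cat big_seq1 /=.
have -> : \sum_(c <- iota b m) y ^+ (b + m.+1 - c.+1) *: diff_row (c + k) =
    y *: \sum_(c <- iota b m) y ^+ (b + m - c.+1) *: diff_row (c + k).
  rewrite scaler_sumr big_seq [RHS]big_seq; apply: eq_bigr => c.
  rewrite mem_iota => hc; rewrite scalerA -exprS.
  by congr (_ ^+ _ *: _); lia.
rewrite -IH (_ : b + m.+1 - (b + m).+1 = 0)%N; last by lia.
rewrite expr0 scale1r /diff_row scalerBr scalerA -exprS [(b + m + k)%N]addnAC addnS.
by rewrite [RHS]addrC addrA subrK.
Qed.

(** Subtracting from the row of each bead a multiple of the next row clears the
    last column; the differences telescope into sums of rows [diff_row c] over
    the sites [c] between consecutive beads, and expanding by linearity gives the
    interlacing shapes. The prefix [s] collects the rows already expanded. *)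
Lemma branch_rows s la : sorted geq la -> (0 < size la)%N ->
  (size s + size la = N.+1)%N ->
  row_det (s ++ map (pow_row N.+1 x) (beta (size la) la)) =
  \sum_(nu <- interlacings la)
    y ^+ (\sum_(j < size nu) (nth 0 la j - nth 0 nu j))%N *
    row_det (s ++ map diff_row (beta (size nu) nu) ++ [:: row (last 0%N la)]).
Proof.
elim: la s => [//|a [|b l] IH] s sla _ sz.
  by rewrite big_seq1 /= big_ord0 expr0 mul1r addn0.
have lts : (size s < N.+1)%N by move: sz => /=; lia.
have ba : (b <= a)%N by case/andP: sla.
rewrite beta_cons map_cons.
have -> : row_det (s ++ row (a + size (b :: l)) ::
      map (pow_row N.+1 x) (beta (size (b :: l)) (b :: l))) =
    row_det (s ++
      (row (a + size (b :: l))%N - y ^+ (a.+1 - b) *: row (b + size l)%N) ::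
      map (pow_row N.+1 x) (beta (size (b :: l)) (b :: l))).
  rewrite addrC -scaleNr row_det_linear // [X in _ * X](_ : _ = 0) ?mulr0 ?add0r //.
  rewrite beta_cons map_cons.
  apply: (@row_det_dup _ _ _ (size s) (size s).+1).
    by move: sz => /=; lia.
  by rewrite !nth_cat ltnn subnn ltnNge leqnSn /= subSnn.
have -> : (a + size (b :: l) = b + size l + (a.+1 - b))%N by rewrite /=; lia.
rewrite diff_row_telescope row_det_sum // [interlacings _]/= big_allpairs_dep.
rewrite big_seq [RHS]big_seq; apply: eq_bigr => c; rewrite mem_iota => hc.
rewrite -cat_rcons IH; last first.
- by move: sz; rewrite size_rcons /=; lia.
- by [].
- by case/andP: sla.
rewrite big_distrr big_seq [RHS]big_seq; apply: eq_bigr => nu nuin.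
have -> : (\sum_(j < size (c :: nu))
      (nth 0 [:: a, b & l] j - nth 0 (c :: nu) j) =
    (a - c) + \sum_(j < size nu) (nth 0 (b :: l) j - nth 0 nu j))%N.
  exact: big_ord_recl.
rewrite beta_cons map_cons exprD cat_rcons [last _ _ in RHS]/= -mulrA.
have -> : (b + (a.+1 - b) - c.+1 = a - c)%N by lia.
have -> : size nu = size l by have := size_interlacings nuin; rewrite /=; lia.
by [].
Qed.

Lemma branch_last_row s a : size s = N ->
  row_det (map diff_row s ++ [:: row a]) =
  y ^+ a * \prod_(i < N) (x i - y) * alternant N x s.
Proof.
move=> szs; rewrite /row_det (expand_det_col _ ord_max) (bigD1 ord_max) //= big1.
  rewrite addr0 !mxE nth_cat size_map szs ltnn subnn /= mxE -mulrA; congr (_ * _).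
  rewrite /cofactor exprD -expr2 sqrr_sign mul1r mulrC /alternant /row_det.
  rewrite -det_scale_col; congr (\det _); apply/matrixP => j i.
  have js : (j < size s)%N by rewrite szs.
  rewrite !mxE nth_cat size_map lift_max js !(nth_map 0%N) // !mxE lift_max.
  by rewrite mulrBr -exprSr [y * _]mulrC.
move=> j jN; rewrite !mxE; have js : (j < size s)%N.
  by rewrite szs; move: jN; rewrite -val_eqE /=; have := ltn_ord j; lia.
rewrite nth_cat size_map js (nth_map 0%N) // !mxE /= -/y -exprS subrr.
by rewrite mul0r.
Qed.

Lemma alternant_branch la : size la = N.+1 -> sorted geq la ->
  alternant N.+1 x (beta N.+1 la) =
  \prod_(i < N) (x i - y) *
  \sum_(nu <- interlacings la) y ^+ strip_size la nu * alternant N x (beta N nu).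
Proof.
move=> szla sla; have := @branch_rows [::] la sla; rewrite szla /= => /(_ isT erefl).
rewrite /alternant => ->; rewrite big_distrr big_seq [RHS]big_seq /=.
apply: eq_bigr => nu nuin.
have sznu : size nu = N by have := size_interlacings nuin; lia.
rewrite sznu branch_last_row ?size_beta // /strip_size sznu exprD !mulrA.
by rewrite mulrAC [_ * \prod_(_ < _) _]mulrC !mulrA.
Qed.

End Branch.

Definition vandermonde_alt (N : nat) : R := alternant N x (beta N (nseq N 0%N)).

Lemma vandermonde_altS N :
  vandermonde_alt N.+1 = \prod_(i < N) (x i - x N) * vandermonde_alt N.
Proof.
have z : interlacings (nseq N.+1 0%N) = [:: nseq N 0%N].
  by elim: N => //= N IH; rewrite IH.
rewrite /vandermonde_alt alternant_branch ?size_nseq //; last first.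
  by apply/(sortedP 0%N) => i; rewrite size_nseq => iN; rewrite !nth_nseq /= !if_same.
rewrite z big_seq1; congr (_ * _).
rewrite /strip_size big1 => [|j _]; last first.
  by rewrite !(@nth_nseq nat) !if_same.
by rewrite (_ : last _ _ = 0%N) ?mul1r //; elim: (N).
Qed.

(** Removing the last variable acts in the same way on alternants
    ([alternant_branch]) and on Schur polynomials ([schur_poly_branch]). *)
Theorem alternant_schur_poly N la : size la = N -> sorted geq la ->
  alternant N x (beta N la) = schur_poly N la * vandermonde_alt N.
Proof.
elim: N la => [|N IH] la szla sla.
  rewrite /schur_poly /= big_seq1 big_nil mul1r.
  by case: la szla {sla}.
rewrite alternant_branch // schur_poly_branch // vandermonde_altS.
rewrite mulrCA; congr (_ * _); rewrite big_distrl big_seq [RHS]big_seq /=.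
apply: eq_bigr => nu nuin; rewrite IH ?mulrA //.
  by have := size_interlacings nuin; lia.
exact: sorted_interlacings nuin.
Qed.

(** Regularity of the differences is all that is asked of [R], because the rule is
    applied to a ring of formal series that is not given as a domain. *)
Lemma vandermonde_lreg N :
  (forall i j, (i < j < N)%N -> GRing.lreg (x i - x j)) ->
  GRing.lreg (vandermonde_alt N).
Proof.
elim: N => [|N IH] reg.
  by rewrite /vandermonde_alt /alternant /row_det det_mx00; exact: lreg1.
rewrite vandermonde_altS; apply: lregM.
  by apply: (big_ind (@GRing.lreg R)) => [|a b|i _]; [exact: lreg1|exact: lregM|];
     apply: reg; rewrite ltn_ord ltnSn.
by apply: IH => i j ij; apply: reg; lia.
Qed.

End Bialternant.

(** * The partitions reached by polyribbons *)

Section PolyribbonLandings.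
Variables (r d N F : nat) (mu : seq nat).
Hypotheses (r0 : (0 < r)%N) (pm : is_part mu) (muN : (size mu + r * d <= N)%N).
Hypothesis bF : all (fun a => a + r * d < F)%N (beta N mu).
Let l := beta N mu.

Definition landing_part (vs : seq nat) : seq nat := unbeta N (foldl (bmove r) l vs).

Lemma sorted_beta_mu : sorted gtn l.
Proof. exact/sorted_beta/is_part_sorted. Qed.

Lemma landing_chain vs : vs \in landings r F 0 l ->
  exists2 gs, polyribbon_chain r mu (landing_part vs) gs & size gs = size vs.
Proof.
rewrite mem_landings => /and3P[mv svs _].
have mN : (size mu <= N)%N by lia.
have [gs [h1 h2 h3 h4 h5]] := moves_chain r0 pm mN mv.
exists gs => //; rewrite /polyribbon_chain h1 h2 h4 h5 eqxx /=.
by rewrite sorted_mtops ?sorted_beta_mu.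
Qed.

Lemma polyribbon_landingsP la : polyribbon r d mu la <->
  la \in [seq landing_part vs | vs <- landings r F 0 l & size vs == d].
Proof.
split=> [[gs c sz]|/mapP[vs]]; last first.
  rewrite mem_filter => /andP[/eqP <- vin] ->.
  by have [gs c sz] := landing_chain vin; exists gs.
have mN : (size mu + r * size gs <= N)%N by rewrite sz.
have [vs [[m s] szv _ laE _]] := polyribbon_chain_moves r0 pm mN c.
apply/mapP; exists vs => //; rewrite mem_filter szv sz eqxx /= mem_landings m s /=.
have [->//|[a al]] : vs = [::] \/ exists a, a \in l.
  case: (vs) m => [|v vs'] /=; first by left.
  by case/andP=> /and3P[_ h _] _; right; exists (v - r)%N.
have /= aF := allP bF a al.
have := mvalid_bound (B := F - r * d) r0 sorted_beta_mu m.
rewrite szv sz subnK; last by lia.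
by apply; apply: sub_all bF => b /=; lia.
Qed.

Lemma uniq_landing_parts :
  uniq [seq landing_part vs | vs <- landings r F 0 l & size vs == d].
Proof.
rewrite map_inj_in_uniq; first by rewrite filter_uniq ?uniq_landings.
have fK vs : mvalid r l vs -> beta N (landing_part vs) = foldl (bmove r) l vs.
  move=> m; rewrite unbetaK //; first exact: mvalid_sorted r0 sorted_beta_mu m.
  by rewrite mvalid_size ?size_beta ?sorted_beta_mu.
move=> vs vs'; rewrite !mem_filter !mem_landings.
move=> /andP[_ /and3P[m s _]] /andP[_ /and3P[m' s' _]] e.
by apply: (mvalid_inj r0 sorted_beta_mu m m' s s'); rewrite -!fK ?e.
Qed.

Lemma polyribbon_sgn_landing vs : vs \in landings r F 0 l -> size vs = d ->
  polyribbon_sgn r mu (landing_part vs) = (-1) ^+ mheight r l vs.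
Proof.
move=> vin szv; have [gs c sz] := landing_chain vin.
rewrite (polyribbon_sgnE r0 pm c).
have mN : (size mu + r * size gs <= N)%N by rewrite sz szv.
have [vs' [[m' s'] _ _ e [-> _]]] := polyribbon_chain_moves r0 pm mN c.
move: vin; rewrite mem_landings => /and3P[m s _].
have fK ws : mvalid r l ws -> beta N (landing_part ws) = foldl (bmove r) l ws.
  move=> mw; rewrite unbetaK //; first exact: mvalid_sorted r0 sorted_beta_mu mw.
  by rewrite mvalid_size ?size_beta ?sorted_beta_mu.
congr (_ ^+ mheight _ _ _); apply: (mvalid_inj r0 sorted_beta_mu m' m s' s).
by rewrite -!fK // [landing_part vs]e.
Qed.


End PolyribbonLandings.

(** * The signed Pieri rule in finitely many variables *)

(** [schur_poly] takes shapes with exactly [N] parts. *)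
Definition pad (N : nat) (mu : seq nat) : seq nat := mkseq (nth 0%N mu) N.

Lemma sorted_pad N mu : is_part mu -> sorted geq (pad N mu).
Proof.
move=> pm; apply/(sortedP 0%N) => i; rewrite size_mkseq => iN.
rewrite !nth_mkseq //; last exact: ltnW.
exact: part_nth_geq (is_part_sorted pm) (leqnSn i).
Qed.

Lemma beta_pad N mu : beta N (pad N mu) = beta N mu.
Proof.
apply: (eq_from_nth (x0 := 0%N)); rewrite !size_beta // => i iN.
by rewrite !nth_beta // nth_mkseq.
Qed.

(** Multiply by the Vandermonde determinant: by the bialternant formula this turns
    Schur polynomials into alternants, where the rule is [alternant_hpow]. *)
Theorem schur_poly_hpow (R : comNzRingType) (x : nat -> R) r d N F mu :
  (0 < r)%N -> is_part mu -> (size mu <= N)%N ->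
  all (fun a => a + r * d < F)%N (beta N mu) ->
  (forall i j, (i < j < N)%N -> GRing.lreg (x i - x j)) ->
  schur_poly x N (pad N mu) * hpow N r x d =
  \sum_(vs <- landings r F 0 (beta N mu) | size vs == d)
    (-1) ^+ mheight r (beta N mu) vs *
    schur_poly x N (pad N (landing_part r N mu vs)).
Proof.
move=> r0 pm mN bF reg; apply: (vandermonde_lreg reg).
have alt g : is_part g ->
    alternant N x (beta N g) = schur_poly x N (pad N g) * vandermonde_alt x N.
  by move=> pg; rewrite -beta_pad alternant_schur_poly ?size_mkseq ?sorted_pad.
have sl := sorted_beta N (is_part_sorted pm).
rewrite mulrA [_ * schur_poly _ _ _]mulrC -alt //.
rewrite (alternant_hpow x r0 sl _ bF) ?size_beta //.
rewrite big_distrr big_seq_cond [RHS]big_seq_cond; apply: eq_bigr => vs.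
rewrite mem_landings => /andP[/and3P[m _ _] _].
have sf := mvalid_sorted r0 sl m.
have szf : size (foldl (bmove r) (beta N mu) vs) = N.
  by rewrite mvalid_size ?size_beta.
rewrite -[foldl _ _ _](unbetaK sf szf) alt ?is_part_unbeta //.
by rewrite mulrA mulrC.
Qed.

(** * Monomials and coefficients of series *)

Lemma fsbig_list (R : Type) (idx : R) (op : Monoid.com_law idx) (T : choiceType)
    (A : set T) (s : seq T) (f : T -> R) : uniq s ->
  (forall i, i \in s -> A i) -> (forall i, A i -> i \notin s -> f i = idx) ->
  \big[op/idx]_(i \in A) f i = \big[op/idx]_(i <- s) f i.
Proof.
move=> us sA fA; rewrite (fsbigE s) // big_seq_cond [RHS]big_seq_cond.
apply: eq_bigl => i; apply: andb_id2l => /sA Ai; exact: mem_set.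
Qed.

Lemma series_sumE (I : Type) (s : seq I) (P : pred I) (f : I -> series) m :
  (\sum_(i <- s | P i) f i) m = \sum_(i <- s | P i) f i m.
Proof. by elim/big_rec2: _ => // i a b _ <-. Qed.

Lemma series_scaleE (a : rat) (f : series) m : (a *: f) m = a * f m.
Proof. by []. Qed.

Lemma series_mulrE (f g : series) m :
  (f * g) m = \sum_(p <- fsplits m) f p.1 * g p.2.
Proof. exact: series_mulE. Qed.

Definition mono (a : monom) : series := fun m => (m == a)%:R.

Lemma mono0 : mono mset0 = 1.
Proof. by []. Qed.

Lemma mono_mulE a f m :
  (mono a * f) m = if (a `<=` m)%mset then f (m `\` a)%mset else 0.
Proof.
rewrite series_mulrE; case: ifP => am.
  rewrite (bigD1_seq (a, (m `\` a)%mset)) ?uniq_fsplits //=; last first.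
    by rewrite mem_fsplits /= msetBDKC.
  rewrite /mono eqxx mul1r big_seq_cond big1 ?addr0 // => -[b c].
  rewrite mem_fsplits /= => /andP[/eqP mE ne]; case: eqP => [ba|_]; last by rewrite mul0r.
  by move: ne; rewrite -mE ba msetDKB eqxx.
rewrite big_seq big1 // => -[b c]; rewrite mem_fsplits /= => /eqP mE.
rewrite /mono; case: eqP => [ba|_]; last by rewrite mul0r.
move: am; rewrite -mE ba => /negP[]; apply/msubsetP => v.
by rewrite msetE2 leq_addr.
Qed.

Lemma mono_mul a b : mono a * mono b = mono (a `+` b)%mset.
Proof.
apply/funext => m; rewrite mono_mulE /mono; case: ifP => am.
  congr (nat_of_bool _)%:R; apply/eqP/eqP => [<-|->]; last by rewrite msetDKB.
  by rewrite msetBDKC.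
case: eqP => // mE; move: am; rewrite mE => /negP[]; apply/msubsetP => v.
by rewrite msetE2 leq_addr.
Qed.

(** The variable [x_{k,i+1}]; numbering from [0] matches the indices of
    [schur_poly] and [hpow]. *)
Definition xser (k i : nat) : series := mono [mset (k.-1, i)]%mset.

Lemma xser_expr k i n : xser k i ^+ n = mono (msetn n (k.-1, i)).
Proof.
elim: n => [|n IH]; first by rewrite msetn0.
rewrite exprS IH mono_mul; congr mono; apply/msetP => v.
by rewrite msetE2 !msetnE; case: eqP.
Qed.

(** If [h] is killed by [x_v - x_w], its coefficient at [m] equals the one at
    [m x_v / x_w], or [0] if [x_w] does not divide [m]; so [h] vanishes by
    induction on the exponent of [x_w]. *)
Lemma mono1_lreg (v w : var) : v != w ->
  GRing.lreg (mono [mset v]%mset - mono [mset w]%mset).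
Proof.
move=> vw f g /eqP; rewrite -subr_eq0 -mulrBr => /eqP h0.
apply/eqP; rewrite -subr_eq0; apply/eqP; move: (f - g) h0 => h h0.
have rec m : h m = if w \in m then h ((v +` m) `\ w)%mset else 0.
  have e : mono [mset v]%mset * h = mono [mset w]%mset * h.
    by apply/eqP; rewrite -subr_eq0 -mulrBl h0.
  have sub : ([mset v] `<=` v +` m)%mset by rewrite msub1set in_mset1D eqxx.
  have := mono_mulE [mset v]%mset h (v +` m)%mset; rewrite sub => e1.
  have := mono_mulE [mset w]%mset h (v +` m)%mset.
  rewrite -e e1 msub1set in_mset1D [w == v]eq_sym (negbTE vw) => <-.
  by rewrite (msetDKB [mset v]%mset m).
apply/funext => m; have [n nE] : exists n, n = m w by eexists.
elim: n m nE => [|n IH] m nE; rewrite rec -mset_gt0 -nE //=.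
by apply: IH; rewrite msetB1E mset1DE eqxx eq_sym (negbTE vw) -nE add0n subn1.
Qed.

Section Within.
Variable P : pred var.

Definition agree (f g : series) : Prop :=
  forall m : monom, {in m, forall v, P v} -> f m = g m.

Lemma agree_mul f f' g g' : agree f f' -> agree g g' -> agree (f * g) (f' * g').
Proof.
move=> ff gg m mP; rewrite !series_mulrE big_seq [RHS]big_seq.
apply: eq_bigr => p; rewrite mem_fsplits => /eqP mE.
by rewrite ff ?gg // => v vin; apply: mP; rewrite -mE in_msetD vin ?orbT.
Qed.

End Within.

Definition mres (P : pred var) (m : monom) : monom :=
  [fsfun v in finsupp m => if P v then m v else 0%N].

Lemma mresE P m v : mres P m v = if P v then m v else 0%N.
Proof.
rewrite fsfunE; case: ifP => // /negbT; rewrite memNfinsupp => /eqP ->.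
by rewrite if_same.
Qed.

Lemma mresD P m : (mres P m `+` mres (predC P) m)%mset = m.
Proof. by apply/msetP => v; rewrite msetE2 !mresE /=; case: (P v); rewrite ?addn0. Qed.

(** Only one splitting of a monomial into monomials in two disjoint sets of
    variables contributes. *)
Lemma mul_disjoint (P Q : pred var) (f g : series) m :
  (forall m, f m != 0 -> {in m, forall v, P v}) ->
  (forall m, g m != 0 -> {in m, forall v, Q v}) ->
  (forall v, P v -> ~~ Q v) ->
  (f * g) m = f (mres P m) * g (mres (predC P) m).
Proof.
move=> fP gQ PQ; rewrite series_mulrE.
rewrite (bigD1_seq (mres P m, mres (predC P) m)) ?uniq_fsplits //=; last first.
  by rewrite mem_fsplits /= mresD.
rewrite big_seq_cond big1 ?addr0 // => -[a b]; rewrite mem_fsplits /=.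
move=> /andP[/eqP mE ne]; apply/eqP; apply: contraNT ne.
rewrite mulf_eq0 negb_or => /andP[/fP aP /gQ bQ].
have aE : a = mres P m.
  apply/msetP => v; rewrite mresE -mE msetE2; case: ifP => [Pv|nP].
    rewrite [b v](_ : _ = 0%N) ?addn0 //; apply/eqP; rewrite mset_eq0.
    by apply/negP => /bQ; apply/negP/PQ.
  by apply/eqP; rewrite mset_eq0; apply/negP => /aP; rewrite nP.
have bE : b = mres (predC P) m.
  move: mE; rewrite -{1}(mresD P m) aE => /(congr1 (msetB^~ (mres P m))).
  by rewrite !msetDKB.
by rewrite aE bE.
Qed.

(** * Complete homogeneous series in r-th powers *)

Implicit Types (P Q : pred var) (m : monom).

(** The sum of the [r]-th powers of the monomials in the variables in [P] of
    weight [d], where the variable [v] has weight [w v]. *)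
Definition hset (P : pred var) (w : var -> nat) (r d : nat) : series :=
  fun m => (all (fun v => P v && (r %| m v)%N) m &&
            (\sum_(v <- m) w v == r * d)%N)%:R.

Lemma eq_hset P Q w r d : P =1 Q -> hset P w r d = hset Q w r d.
Proof.
move=> PQ; apply/funext => m; rewrite /hset.
by congr (nat_of_bool (_ && _))%:R; apply: eq_all => v; rewrite PQ.
Qed.

Lemma perm_msetD (a b : monom) : perm_eq (a `+` b)%mset (a ++ b).
Proof.
apply/allP => v _ /=.
by rewrite count_cat !count_mem_mset msetE2.
Qed.

Lemma weight_msetD (w : var -> nat) (a b : monom) :
  (\sum_(v <- (a `+` b)%mset) w v = \sum_(v <- a) w v + \sum_(v <- b) w v)%N.
Proof. by rewrite (perm_big _ (perm_msetD a b)) big_cat. Qed.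

Lemma hset_neq0 P w r d m : hset P w r d m != 0 -> {in m, forall v, P v}.
Proof.
rewrite /hset; case: allP => [al _ v vin|_]; last by rewrite eqxx.
by case/andP: (al v vin).
Qed.

Lemma mem_mres P m v : (v \in mres P m) = (v \in m) && P v.
Proof. by rewrite !in_mset mresE; case: (P v); rewrite ?andbT ?andbF. Qed.

Lemma weight_dvd P (w : var -> nat) r (m : monom) :
  all (fun v => P v && (r %| m v)%N) m -> (r %| \sum_(v <- m) w v)%N.
Proof.
move=> /allP al; rewrite sum_mset big_seq; apply: dvdn_sum => v.
by rewrite msuppE => /al /andP[_]; exact: dvdn_mulr.
Qed.

(** The rule [h_d(x, y) = \sum_e h_e(x) h_(d - e)(y)] for disjoint alphabets. *)
Lemma hset_split P Q w r d : (0 < r)%N -> (forall v, P v -> ~~ Q v) ->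
  hset (predU P Q) w r d =
  \sum_(e < d.+1) hset P w r e * hset Q w r (d - e).
Proof.
move=> r0 PQ; apply/funext => m; rewrite series_sumE.
have -> : \sum_(e < d.+1) (hset P w r e * hset Q w r (d - e)) m =
    \sum_(e < d.+1) hset P w r e (mres P m) * hset Q w r (d - e) (mres (predC P) m).
  by apply: eq_bigr => e _; apply: (mul_disjoint (Q := Q)) => // m';
     exact: hset_neq0.
rewrite /hset -[in X in _ && X](mresD P m) weight_msetD.
set m1 := mres P m; set m2 := mres (predC P) m.
have -> : all (fun v => predU P Q v && (r %| m v)%N) m =
    all (fun v => P v && (r %| m1 v)%N) m1 && all (fun v => Q v && (r %| m2 v)%N) m2.
  apply/allP/andP => [al|[/allP a1 /allP a2] v vin].
    split; apply/allP => v; rewrite mem_mres mresE.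
      move=> /andP[/al /andP[/= PQv rv] Pv].
      by rewrite Pv.
    move=> /andP[/al /andP[/= PQv rv] Pv].
    by move: PQv; rewrite Pv rv (negbTE Pv) /= andbT.
  have [Pv|Pv] := boolP (P v).
    have /a1 : v \in m1 by rewrite mem_mres vin.
    by rewrite mresE Pv /= Pv.
  have /a2 : v \in m2 by rewrite mem_mres vin.
  by rewrite mresE /= Pv (negbTE Pv).
case: (boolP (all _ m1)) => [a1|_] /=; last first.
  by rewrite big1 // => e _; rewrite mul0r.
case: (boolP (all _ m2)) => [a2|_] /=; last first.
  by rewrite big1 // => e _; rewrite mulr0.
have /dvdnP[e1 ->] := weight_dvd w a1; have /dvdnP[e2 ->] := weight_dvd w a2.
rewrite -mulnDl mulnC eqn_pmul2l //.
have -> : \sum_(e < d.+1) ((e1 * r == r * e)%N%:R * (e2 * r == r * (d - e))%N%:R : rat) =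
    \sum_(e < d.+1 | (e : nat) == e1) (e2 == d - e1)%N%:R.
  rewrite [RHS]big_mkcond; apply: eq_bigr => e _.
  rewrite mulnC eqn_pmul2l // [(e2 * r)%N]mulnC eqn_pmul2l // eq_sym.
  by case: eqP => [->|_]; rewrite ?mul1r ?mul0r.
have [le|gt] := leqP e1 d.
  rewrite (big_pred1 (Ordinal (le : (e1 < d.+1)%N))) => [|e]; last first.
    by rewrite /= -val_eqE.
  by congr (nat_of_bool _)%:R; apply/eqP/eqP; lia.
rewrite big_pred0 => [|e]; last by apply/eqP; have := ltn_ord e; lia.
by case: eqP => //; lia.
Qed.

Lemma hset_pred1 (v : var) r d :
  hset (pred1 v) (fun=> 1%N) r d = mono (msetn (r * d)%N v).
Proof.
apply/funext => m; rewrite /hset /mono sum1_size; congr (nat_of_bool _)%:R.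
apply/andP/eqP => [[/allP al /eqP sz]|->].
  apply/msetP => u; rewrite msetnE -sz.
  have mE : forall u, u != v -> m u = 0%N.
    move=> u' uv; apply/eqP; rewrite mset_eq0; apply: contraNN uv.
    by move/al => /andP[].
  case: (eqVneq u v) => [->|]; last exact: mE.
  rewrite -count_mem_mset; apply/eqP; rewrite -all_count.
  by apply/allP => u' /al /andP[].
rewrite enum_msetn size_nseq eqxx; split=> //.
by apply/allP => u /nseqP[-> _]; rewrite /= eqxx msetnxx dvdn_mulr.
Qed.

Lemma hpow_hset k N r d : (0 < r)%N ->
  hpow N r (xser k) d =
  hset (fun v => (v.1 == k.-1) && (v.2 < N)%N) (fun=> 1%N) r d.
Proof.
move=> r0; rewrite /hpow.
suff coefE D e : (e <= D)%N ->
    (\prod_(i < N) \poly_(s < D.+1) xser k i ^+ (r * s))`_e =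
    hset (fun v => (v.1 == k.-1) && (v.2 < N)%N) (fun=> 1%N) r e.
  exact: coefE.
elim: N e => [|N IH] e eD.
  rewrite big_ord0 coef1; apply/funext => m.
  have -> : ((e == 0%N)%:R : series) m = ((e == 0%N) && (m == mset0))%:R.
    by case: (e == 0%N).
  rewrite /hset sum1_size; congr (nat_of_bool _)%:R.
  rewrite (eq_all (a2 := pred0)); last by move=> v; rewrite ltn0 andbF.
  rewrite all_pred0 size_mset_eq0; case: (eqVneq m mset0) => [->|]; last first.
    by rewrite andbF.
  by rewrite size_mset0 andbT /= [in RHS]eq_sym muln_eq0 (gtn_eqF r0).
rewrite big_ord_recr coefM /=.
rewrite -(@eq_hset (predU (fun v : var => (v.1 == k.-1) && (v.2 < N)%N)
                          (pred1 (k.-1, N)))).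
  rewrite hset_split //; last first.
    by move=> [a b] /= /andP[_ bN]; apply/negP => /eqP[_ e']; rewrite e' ltnn in bN.
  apply: eq_bigr => j _; have jD : (j <= D)%N by have := ltn_ord j; lia.
  by rewrite IH // coef_poly ltnS (leq_trans (leq_subr _ _)) // xser_expr hset_pred1.
move=> [a b] /=; rewrite xpair_eqE; case: (a == _) => //=.
by rewrite ltnS [RHS]leq_eqVlt orbC.
Qed.

(** * Schur series *)

Lemma prod_xser k T : \prod_(e <- flatten T) xser k e.-1 = mono (tab_monom k T).
Proof.
rewrite /tab_monom; elim: (flatten T) => [|e s IH] /=.
  by rewrite big_nil -mono0; congr mono; apply/msetP => v; rewrite mset_seqE mset0E.
rewrite big_cons IH mono_mul; congr mono; apply/msetP => v.
by rewrite mset1DE !mset_seqE /= [v == _]eq_sym.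
Qed.

Lemma nth_take_tab N la T j : (size la <= N)%N -> ssyt_le N (pad N la) T ->
  nth [::] (take (size la) T) j = nth [::] T j.
Proof.
move=> laN /ssyt_leP[h1 h2 _ _ _].
have [lt|ge] := ltnP j (size la); first by rewrite nth_take.
rewrite nth_default; last by rewrite size_take; case: ifP; lia.
apply/esym/eqP; rewrite -size_eq0 h2.
have [jN|jN] := ltnP j N; last by rewrite nth_default ?size_mkseq.
by rewrite nth_mkseq // nth_default.
Qed.

Lemma nth_pad N la j : (size la <= N)%N -> nth 0%N (pad N la) j = nth 0%N la j.
Proof.
move=> laN; have [jN|jN] := ltnP j N; first by rewrite nth_mkseq.
by rewrite !nth_default ?size_mkseq //; lia.
Qed.

Lemma mem_take_tabs N la T : is_part la -> (size la <= N)%N ->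
  (T \in [seq take (size la) T' | T' <- tabs N (pad N la)]) = ssyt_le N la T.
Proof.
move=> pla laN; have memt T' := mem_tabs T' (size_mkseq _ _) (sorted_pad N pla).
apply/mapP/idP => [[T']|ss].
  rewrite memt => ss ->; have nthE j := nth_take_tab j laN ss.
  move: ss => /ssyt_leP[h1 h2 h3 h4 h5]; apply/ssyt_leP; split.
  - by rewrite size_takel // h1 size_mkseq.
  - by move=> j; rewrite nthE h2 nth_pad.
  - by move=> j; rewrite nthE.
  - by move=> j; rewrite nthE.
  - by move=> j jl; rewrite !nthE; apply: h5; rewrite size_mkseq; lia.
have /ssyt_leP[h1 h2 h3 h4 h5] := ss.
exists (T ++ nseq (N - size la) [::]); last by rewrite take_size_cat.
have nthE j : nth [::] (T ++ nseq (N - size la) [::]) j = nth [::] T j.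
  rewrite nth_cat; case: ltnP => // ge; rewrite [RHS]nth_default //.
  by rewrite nth_nseq if_same.
rewrite memt; apply/ssyt_leP; split.
- by rewrite size_cat size_nseq size_mkseq h1 subnKC.
- by move=> j; rewrite nthE h2 nth_pad.
- by move=> j; rewrite nthE.
- by move=> j; rewrite nthE.
move=> j jl; rewrite !nthE; have [lt|ge] := ltnP j.+1 (size la); first exact: h5.
by apply/row_ltP => c; rewrite h2 nth_default.
Qed.

(** A monomial in the first [N] variables only sees the tableaux with entries at
    most [N]. *)
Lemma schur_agree k N la : is_part la -> (size la <= N)%N ->
  agree (fun v => v.2 < N)%N (schur k la) (schur_poly (xser k) N (pad N la)).
Proof.
move=> pla laN m mN; have memt T' := mem_tabs T' (size_mkseq _ _) (sorted_pad N pla).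
have takeK T : T \in tabs N (pad N la) ->
    T = take (size la) T ++ nseq (N - size la) [::].
  rewrite memt => ss; have nthE j := nth_take_tab j laN ss.
  have /ssyt_leP[h1 _ _ _ _] := ss; rewrite size_mkseq in h1.
  apply: (eq_from_nth (x0 := [::])).
    by rewrite size_cat size_nseq size_takel h1 // subnKC.
  move=> j jT; rewrite nth_cat size_takel ?h1 // nthE; case: ltnP => // ge.
  by rewrite nth_nseq if_same -nthE nth_default // size_takel ?h1.
rewrite /schur (@fsbig_list _ _ _ _ _ [seq take (size la) T | T <- tabs N (pad N la)]).
- rewrite big_map /schur_poly series_sumE big_seq [RHS]big_seq.
  apply: eq_bigr => T Tin; rewrite prod_xser /mono eq_sym.
  congr (nat_of_bool (_ == _))%:R; rewrite /tab_monom {2}(takeK _ Tin) flatten_cat.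
  rewrite (_ : flatten (nseq _ _) = [::]) ?cats0 //.
  by elim: (N - _)%N.
- rewrite map_inj_in_uniq; first by rewrite uniq_tabs ?size_mkseq ?sorted_pad.
  by move=> T T' /takeK {2}-> /takeK {2}-> ->.
- by move=> T; rewrite mem_take_tabs // => /andP[].
move=> T /= ss; rewrite mem_take_tabs // /ssyt_le ss /=; case: eqP => // mE al.
case/negP: al; apply/allP => R RT; apply/allP => e eR /=.
have : (k.-1, e.-1) \in m.
  rewrite -mE (perm_mem (perm_eq_seq_mset _)); apply/mapP; exists e => //.
  by apply/flattenP; exists R.
by move/mN => /=; lia.
Qed.

(** * The signed Pieri rule in one alphabet *)

(** Any larger [N] gives the same list up to order, by [polyribbon_landingsP]. *)
Definition polyribbons (r d : nat) (mu : seq nat) : seq (seq nat) :=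
  let N := (size mu + r * d)%N in
  let F := (\max_(a <- beta N mu) a + r * d).+1 in
  [seq landing_part r N mu vs | vs <- landings r F 0 (beta N mu) & size vs == d].

Lemma max_bound (s : seq nat) c :
  all (fun a => a + c < (\max_(b <- s) b + c).+1)%N s.
Proof.
apply/allP => a ain; rewrite ltnS leq_add2r.
exact: (leq_bigmax_seq (F := id) a ain).
Qed.

Lemma mem_polyribbons r d mu la : (0 < r)%N -> is_part mu ->
  polyribbon r d mu la <-> la \in polyribbons r d mu.
Proof.
by move=> r0 pm; apply: polyribbon_landingsP => //; exact: max_bound.
Qed.

Lemma uniq_polyribbons r d mu : (0 < r)%N -> is_part mu ->
  uniq (polyribbons r d mu).
Proof. by move=> r0 pm; apply: uniq_landing_parts. Qed.

(** The coefficient of a monomial is computed with finitely many variables: those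
    of the monomial, and enough of them to accommodate all the shapes that
    occur. *)
Theorem schur_hset k r d mu : (0 < r)%N -> is_part mu ->
  schur k mu * hset (fun v => v.1 == k.-1) (fun=> 1%N) r d =
  \sum_(la <- polyribbons r d mu) polyribbon_sgn r mu la *: schur k la.
Proof.
move=> r0 pm; apply/funext => m.
pose N := (size mu + r * d + \sum_(v <- m) v.2.+1)%N.
have mN : {in m, forall v, (v.2 < N)%N}.
  move=> v vin; rewrite /N (big_rem v) //=; lia.
have szN : (size mu + r * d <= N)%N by rewrite leq_addr.
have muN : (size mu <= N)%N by lia.
pose F := (\max_(a <- beta N mu) a + r * d).+1.
have bF := max_bound (beta N mu) (r * d).
have -> : (schur k mu * hset (fun v => v.1 == k.-1) (fun=> 1%N) r d) m =
    (schur_poly (xser k) N (pad N mu) * hpow N r (xser k) d) m.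
  apply: (agree_mul (P := fun v => v.2 < N)%N) mN; first exact: schur_agree.
  move=> m' m'N; rewrite hpow_hset // /hset; congr (nat_of_bool (_ && _))%:R.
  by apply: eq_in_all => v /m'N ->; rewrite andbT.
rewrite (@schur_poly_hpow _ (xser k) r d N F) //; last first.
  move=> i j /andP[ij _]; apply: mono1_lreg; rewrite xpair_eqE eqxx /=.
  by rewrite ltn_eqF.
have lp := polyribbon_landingsP r0 pm szN bF.
have pE : perm_eq (polyribbons r d mu)
   [seq landing_part r N mu vs | vs <- landings r F 0 (beta N mu) & size vs == d].
  apply: uniq_perm; [exact: uniq_polyribbons | exact: uniq_landing_parts |].
  by move=> la; have mP := mem_polyribbons d la r0 pm; apply/idP/idP => [/mP/lp|/lp/mP].
rewrite (perm_big _ pE) big_map big_filter !series_sumE.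
rewrite big_seq_cond [RHS]big_seq_cond; apply: eq_bigr => vs /andP[vin /eqP szv].
rewrite (polyribbon_sgn_landing r0 pm szN bF vin szv) series_scaleE.
have -> : (-1) ^+ mheight r (beta N mu) vs =
    ((-1) ^+ mheight r (beta N mu) vs : rat) *: 1 :> series.
  rewrite -[LHS]signr_odd -[in RHS]signr_odd.
  by case: odd; rewrite ?scaleN1r ?scale1r.
rewrite -scalerAl mul1r series_scaleE; congr (_ * _); apply/esym.
apply: schur_agree mN; last by rewrite /landing_part size_unbeta.
have [gs /and4P[pgs /eqP <- _ _] _] := landing_chain r0 pm szN bF vin.
by case/lastP: gs pgs => // gs g; rewrite all_rcons last_rcons => /andP[].
Qed.

(** * Types, one degree at a time *)

Lemma block_ge_trans : transitive block_ge.
Proof. by move=> [a b] [c d] [e f]; rewrite /block_ge /=; lia. Qed.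

Lemma is_part_restr tau k : is_type tau -> is_part (restr tau k).
Proof.
case/andP=> st pt; apply/andP; split.
  have hom : {in [pred b : nat * nat | b.1 == k] &,
      {homo snd : b c / block_ge b c >-> (c <= b)%N}}.
    by move=> [a b] [c d] /eqP/= -> /eqP/= ->; rewrite /block_ge /=; lia.
  apply: (homo_sorted_in hom); first exact: filter_all.
  exact: sorted_filter block_ge_trans _ _ st.
apply/allP => x /mapP[b]; rewrite mem_filter => /andP[_ /(allP pt)/andP[_ ?]] ->.
by [].
Qed.

Definition blocks (k : nat) (nu : seq nat) : seq (nat * nat) := [seq (k, b) | b <- nu].

Lemma blocks_restr k tau : blocks k (restr tau k) = [seq b <- tau | b.1 == k].
Proof.
elim: tau => [//|[a b] tau IH]; rewrite /restr /= -[in RHS]IH.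
by case: eqP => //= ->.
Qed.

Lemma restr_blocks_cat k nu tau j : all (fun b => b.1 < k)%N tau ->
  restr (blocks k nu ++ tau) j = if j == k then nu else restr tau j.
Proof.
move=> tk; rewrite /restr filter_cat map_cat; case: eqP => [->|jk].
  rewrite (_ : filter _ tau = [::]) ?cats0.
    by elim: nu => //= b nu IH; rewrite eqxx /= IH.
  apply/eqP; rewrite -size_eq0 size_filter -leqn0 leqNgt -has_count.
  by apply/hasPn => b /(allP tk) /=; lia.
rewrite (_ : filter _ (blocks k nu) = [::]) //.
apply/eqP; rewrite -size_eq0 size_filter -leqn0 leqNgt -has_count.
by apply/hasPn => _ /mapP[b _ ->] /=; apply/eqP => kj; case: jk.
Qed.

(** The blocks of largest degree come first. *)
Lemma type_split k tau : is_type tau -> all (fun b => b.1 <= k)%N tau ->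
  tau = blocks k (restr tau k) ++ [seq b <- tau | b.1 < k]%N.
Proof.
rewrite blocks_restr => /andP[st _]; elim: tau st => //= b tau IH pt /andP[bk tk].
have [e|ne] := eqVneq b.1 k; first by rewrite e ltnn /= -IH // (path_sorted pt).
have bk' : (b.1 < k)%N by lia.
have lt : {in tau, forall c, (c.1 < k)%N}.
  move=> c ctau; have /allP/(_ c ctau) := order_path_min block_ge_trans pt.
  by rewrite /block_ge /=; lia.
rewrite bk' (_ : [seq _ <- tau | _ == k] = [::]) /=.
  by congr (_ :: _); apply/esym/all_filterP/allP.
apply/eqP; rewrite -size_eq0 size_filter -leqn0 leqNgt -has_count.
by apply/hasPn => c /lt /=; lia.
Qed.

Lemma is_type_blocks_cat k nu tau : (0 < k)%N -> is_part nu -> is_type tau ->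
  all (fun b => b.1 < k)%N tau -> is_type (blocks k nu ++ tau).
Proof.
move=> k0 /andP[snu pnu] /andP[st pt] tk; apply/andP; split; last first.
  rewrite all_cat pt andbT; apply/allP => _ /mapP[b /(allP pnu) b1 ->].
  by rewrite /is_block /= k0.
rewrite (sorted_pairwise block_ge_trans) pairwise_cat -!(sorted_pairwise block_ge_trans) st.
apply/and3P; split=> //.
  by apply/allrelP => _ c /mapP[b _ ->] /(allP tk); rewrite /block_ge /=; lia.
rewrite /blocks sorted_map; apply: sub_sorted snu => a b /=.
by rewrite /block_ge /= ltnn eqxx.
Qed.

Lemma is_part_polyribbon r d mu la : is_part mu -> polyribbon r d mu la -> is_part la.
Proof.
move=> pm [gs /and4P[pgs /eqP <- _ _] _].
by case/lastP: gs pgs => // gs g; rewrite all_rcons last_rcons => /andP[].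
Qed.

Lemma polyribbon0 r mu : polyribbon r 0 mu mu.
Proof. by exists [::] => //; rewrite /polyribbon_chain /= eqxx. Qed.

Lemma polyribbon0_eq r mu la : polyribbon r 0 mu la -> la = mu.
Proof. by move=> [gs /and4P[_ /eqP <- _ _] /size0nil ->]. Qed.

Definition multiples (k d : nat) : seq nat :=
  [seq e <- iota 0 d.+1 | (k %| e)%N].

Section Types.
Variables (r : nat) (sigma : seq (nat * nat)).
Hypotheses (r0 : (0 < r)%N) (tsigma : is_type sigma).

(** The types with degrees at most [K] obtained from the blocks of [sigma] of
    these degrees by means of a partition of [d]; [e] is the part of [d]
    contributed by the degree [K]. *)
Fixpoint type_list (K d : nat) : seq (seq (nat * nat)) :=
  if K is K'.+1 then
    [seq blocks K p.1 ++ p.2 | e <- multiples K d,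
      p <- [seq (nu, tau) | nu <- polyribbons r (e %/ K) (restr sigma K),
                            tau <- type_list K' (d - e)]]
  else if d == 0%N then [:: [::]] else [::].

Lemma type_listS K d : type_list K.+1 d =
  [seq blocks K.+1 p.1 ++ p.2 | e <- multiples K.+1 d,
    p <- [seq (nu, tau) | nu <- polyribbons r (e %/ K.+1) (restr sigma K.+1),
                          tau <- type_list K (d - e)]].
Proof. by []. Qed.

Definition obtained_le (K d : nat) (tau : seq (nat * nat)) : Prop :=
  [/\ is_type tau, all (fun b => b.1 <= K)%N tau &
    exists la, [/\ is_part la, all (fun p => p <= K)%N la, sumn la = d &
      forall k, (0 < k <= K)%N ->
        polyribbon r (count_mem k la) (restr sigma k) (restr tau k)]].

Lemma type_listP K d tau : tau \in type_list K d <-> obtained_le K d tau.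
Proof.
elim: K d tau => [|K IH] d tau.
  rewrite [type_list _ _]/=; split.
    case: eqP => // -> /[!inE] /eqP ->; split=> //; exists [::]; split=> // k.
    by lia.
  move=> [tt al [la [pla lla <- _]]].
  have -> : tau = [::].
    case: tau tt al => // -[a b] tau /andP[_ /=/andP[/andP[/= a0 _] _]] /andP[/= a0' _].
    by lia.
  by case: la pla lla => //= a la /andP[_ /= /andP[a0 _]] /andP[]; lia.
rewrite type_listS; split.
  case/allpairsPdep=> e [p [ein pin ->]].
  case/allpairsP: pin => -[nu tau'] [/= nuin tin ->] /=.
  move: ein; rewrite mem_filter mem_iota => /andP[Ke ed].
  have [tt al [la [pla lla sla pol]]] := (IH _ _).1 tin.
  have pnu := (mem_polyribbons _ _ r0 (is_part_restr K.+1 tsigma)).2 nuin.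
  have al' : all (fun b => b.1 < K.+1)%N tau' by [].
  split.
  - exact: is_type_blocks_cat (is_part_polyribbon (is_part_restr _ tsigma) pnu) tt al'.
  - rewrite all_cat; apply/andP; split; last by apply: sub_all al => b /=; lia.
    by apply/allP => _ /mapP[b _ ->] /=.
  exists (nseq (e %/ K.+1) K.+1 ++ la); split.
  - apply/andP; split; last first.
      rewrite all_cat; apply/andP; split; last by case/andP: pla.
      by apply/allP => a /nseqP[-> _].
    have tr : transitive geq by move=> a b c /=; lia.
    rewrite (sorted_pairwise tr) pairwise_cat -!(sorted_pairwise tr).
    apply/and3P; split; last by case/andP: pla.
      by apply/allrelP => a b /nseqP[-> _] /(allP lla) /=; lia.
    apply/(sortedP 0%N) => i; rewrite size_nseq => ii.
    by rewrite !nth_nseq ii ltnW /=.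
  - rewrite all_cat; apply/andP; split; first by apply/allP => a /nseqP[-> _].
    by apply: sub_all lla => a /=; lia.
  - by rewrite sumn_cat sumn_nseq sla mulnC divnK //; lia.
  move=> k kK; rewrite restr_blocks_cat // count_cat count_nseq /=.
  have [->|kK'] := eqVneq k K.+1.
    rewrite mul1n (count_memPn _) ?addn0 //.
    by apply/negP => /(allP lla) /=; lia.
  by rewrite mul0n add0n; apply: pol; lia.
move=> [tt al [la [pla lla sla pol]]].
set n := count_mem K.+1 la; pose la' := [seq a <- la | (a <= K)%N].
have laE : (sumn la = n * K.+1 + sumn la')%N.
  rewrite /n /la'; elim: (la) lla => //= a s IHs /andP[aK /IHs ->].
  have [->|ne] := eqVneq a K.+1; first by rewrite ltnn mulSn addnA.
  by rewrite (_ : (a <= K)%N) /=; lia.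
apply/allpairsPdep; exists (n * K.+1)%N.
exists (restr tau K.+1, [seq b <- tau | (b.1 < K.+1)%N]); split.
- by rewrite mem_filter dvdn_mull // mem_iota; lia.
- rewrite mulnK //; apply/allpairsP.
  exists (restr tau K.+1, [seq b <- tau | (b.1 < K.+1)%N]); split=> //=.
    by apply/(mem_polyribbons _ _ r0 (is_part_restr _ tsigma))/pol; rewrite ltnS leqnn.
  apply/IH; split.
  - case/andP: tt => st pt; apply/andP; split.
      exact: sorted_filter block_ge_trans _ _ st.
    by apply/allP => b; rewrite mem_filter => /andP[_]; exact: (allP pt).
  - exact: filter_all.
  exists la'; split.
  - case/andP: pla => s1 s2; apply/andP; split.
      by apply: sorted_filter s1 => a b c /=; lia.
    by apply/allP => b; rewrite mem_filter => /andP[_]; exact: (allP s2).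
  - exact: filter_all.
  - by lia.
  move=> k kK; have := pol k; have -> : count_mem k la' = count_mem k la.
    rewrite count_filter; apply: eq_count => a /=.
    by case: eqP => //= ->; lia.
  have -> : restr [seq b <- tau | (b.1 < K.+1)%N] k = restr tau k.
    rewrite /restr -filter_predI; congr map; apply: eq_filter => b /=.
    by case: eqP => //= ->; lia.
  by apply; lia.
exact: type_split.
Qed.

Lemma uniq_type_list K d : uniq (type_list K d).
Proof.
elim: K d => [|K IH] d; first by rewrite /=; case: eqP.
rewrite type_listS; apply: allpairs_uniq_dep.
- by rewrite filter_uniq ?iota_uniq.
- move=> e _; apply: allpairs_uniq; rewrite ?uniq_polyribbons ?is_part_restr //.
  by move=> [a b] [c f] _ _ /= [-> ->].
have ok e p : e \in multiples K.+1 d ->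
    p \in [seq (nu, tau) | nu <- polyribbons r (e %/ K.+1) (restr sigma K.+1),
                            tau <- type_list K (d - e)] ->
    [/\ (K.+1 %| e)%N, polyribbon r (e %/ K.+1) (restr sigma K.+1) p.1 &
      all (fun b => b.1 < K.+1)%N p.2].
  rewrite mem_filter => /andP[Ke _] /allpairsP[[nu tau] [/= nuin tin ->]].
  split=> //=; first exact/(mem_polyribbons _ _ r0 (is_part_restr K.+1 tsigma)).
  by have [] := (type_listP K _ _).1 tin.
move=> u1 u2 /allpairsPdep[e1 [p1 [e1in p1in ->]]].
move=> /allpairsPdep[e2 [p2 [e2in p2in ->]]].
have [K1 pr1 al1] := ok _ _ e1in p1in; have [K2 pr2 al2] := ok _ _ e2in p2in.
rewrite /= => e.
have nuE : p1.1 = p2.1.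
  by have := congr1 (restr^~ K.+1) e; rewrite !restr_blocks_cat // eqxx.
have tauE : p1.2 = p2.2.
  by move: e => /eqP; rewrite nuE eqseq_cat // eqxx => /eqP.
have [[gs1 c1 s1] [gs2 c2 s2]] := (pr1, pr2); rewrite -nuE in c2.
have eE : e1 = e2.
  rewrite -(divnK K1) -(divnK K2) -s1 -s2.
  by rewrite (polyribbon_chain_uniq r0 (is_part_restr K.+1 tsigma) c1 c2).
by rewrite eE [p1]surjective_pairing [p2]surjective_pairing nuE tauE.
Qed.

(** In the variables of degree [k], weighted degree is [k] times the number of
    variables. *)
Lemma hset_degree k d : (0 < k)%N ->
  hset (fun v => v.1 == k.-1) vdeg r d =
  if (k %| d)%N then hset (fun v => v.1 == k.-1) (fun=> 1%N) r (d %/ k) else 0.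
Proof.
move=> k0; apply/funext => m.
have wE : all (fun v => (v.1 == k.-1) && (r %| m v)%N) m ->
    (\sum_(v <- m) vdeg v = k * \sum_(v <- m) 1)%N.
  move=> /allP al; rewrite big_distrr /= big_seq [RHS]big_seq.
  apply: eq_bigr => v /al/andP[/eqP e _].
  by rewrite /vdeg e prednK // muln1.
rewrite /hset; case: (boolP (all _ _)) => [al|nal] /=; last first.
  by case: ifP => // _; rewrite (negbTE nal).
rewrite wE //; case: ifP => [/dvdnP[n ->]|nd].
  by rewrite al mulnK // mulnA [(_ * k)%N]mulnC eqn_pmul2l.
case: eqP => // e; have /dvdnP[s sE] := weight_dvd (fun=> 1%N) al.
move: nd => /negP[]; apply/dvdnP; exists s.
by apply/eqP; rewrite -(eqn_pmul2l r0) -e sE; apply/eqP; lia.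
Qed.

(** Induction on the largest degree: [hset_split] separates its variables from the
    others and [schur_hset] multiplies in its alphabet. *)
Theorem schur_hset_degrees K d :
  \prod_(k < K) schur k.+1 (restr sigma k.+1) * hset (fun v => v.1 < K)%N vdeg r d =
  \sum_(tau <- type_list K d)
    (\prod_(k < K) polyribbon_sgn r (restr sigma k.+1) (restr tau k.+1)) *:
      \prod_(k < K) schur k.+1 (restr tau k.+1).
Proof.
elim: K d => [|K IH] d.
  rewrite big_ord0 mul1r; apply/funext => m; rewrite /hset.
  rewrite (eq_all (a2 := pred0)); last by move=> v; rewrite ltn0.
  rewrite all_pred0 size_mset_eq0 /=; case: (eqVneq m mset0) => [->|m0] /=.
    rewrite big_mset0 [0%N == _]eq_sym muln_eq0 (gtn_eqF r0) /=.
    case: eqP => _; last by rewrite big_nil.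
    by rewrite big_seq1 !big_ord0 scale1r -mono0 /mono eqxx.
  case: eqP => _; last by rewrite big_nil.
  by rewrite big_seq1 !big_ord0 scale1r -mono0 /mono (negbTE m0).
rewrite big_ord_recr type_listS.
rewrite -(@eq_hset (predU (fun v : var => v.1 == K)
                          (fun v : var => v.1 < K)%N)); last first.
  by move=> v /=; rewrite ltnS [RHS]leq_eqVlt.
rewrite hset_split //; last by move=> v /eqP ->; rewrite ltnn.
rewrite big_allpairs_dep /= big_filter -[iota 0 d.+1]/(iota 0 (d.+1 - 0)).
rewrite -/(index_iota 0 d.+1).
rewrite big_mkord [RHS]big_mkcond big_distrr /=; apply: eq_bigr => e _.
rewrite (@hset_degree K.+1) //=; case: ifP => Ke; last by rewrite mul0r mulr0.
rewrite [X in X * _]mulrC mulrACA IH (@schur_hset K.+1) ?is_part_restr //.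

rewrite big_allpairs big_distrlr /=; apply: eq_bigr => nu _.
rewrite big_seq [RHS]big_seq; apply: eq_bigr => tau.
case/type_listP=> _ al _; have al' : all (fun b => b.1 < K.+1)%N tau by [].
rewrite !big_ord_recr /= !restr_blocks_cat // eqxx.
have resE (k : 'I_K) : restr (blocks K.+1 nu ++ tau) k.+1 = restr tau k.+1.
  by rewrite restr_blocks_cat // eqSS ltn_eqF.
have -> : \prod_(k < K) polyribbon_sgn r (restr sigma k.+1)
      (restr (blocks K.+1 nu ++ tau) k.+1) =
    \prod_(k < K) polyribbon_sgn r (restr sigma k.+1) (restr tau k.+1).
  by apply: eq_bigr => k _; rewrite resE.
have -> : \prod_(k < K) schur k.+1 (restr (blocks K.+1 nu ++ tau) k.+1) =
    \prod_(k < K) schur k.+1 (restr tau k.+1).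
  by apply: eq_bigr => k _; rewrite resE.
rewrite -scalerAl -scalerAr scalerA [schur _ _ * _]mulrC.
by rewrite [polyribbon_sgn _ _ nu * _]mulrC.
Qed.

End Types.

(** * The product of a Schur tensor with a block *)

Lemma mpowE r (n : monom) v : mpow r n v = (r * n v)%N.
Proof.
rewrite fsfunE; case: ifP => // /negbT; rewrite memNfinsupp => /eqP ->.
by rewrite muln0.
Qed.

Lemma mdegE (m : monom) : mdeg m = (\sum_(v <- m) vdeg v)%N.
Proof. by rewrite sum_mset; apply: eq_bigr => v _; rewrite mulnC. Qed.

Lemma mdeg_mpow r (n : monom) : (0 < r)%N -> mdeg (mpow r n) = (r * mdeg n)%N.
Proof.
move=> r0; rewrite /mdeg.
have -> : finsupp (mpow r n) = finsupp n.
  by apply/fsetP => v; rewrite !mem_finsupp mpowE muln_eq0 (gtn_eqF r0).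
by rewrite big_distrr /=; apply: eq_bigr => v _; rewrite mpowE mulnCA.
Qed.

Lemma hblock_hset d r : (0 < r)%N -> hblock d r = hset predT vdeg r d.
Proof.
move=> r0; apply/funext => m; rewrite /hblock /subst_pow /hset.
case: allP => [al|nal] /=.
  pose n : monom := [fsfun v in finsupp m => (m v %/ r)%N].
  have nE v : n v = (m v %/ r)%N.
    rewrite fsfunE; case: ifP => // /negbT; rewrite memNfinsupp => /eqP ->.
    by rewrite div0n.
  have mE : mpow r n = m.
    apply/msetP => v; rewrite mpowE nE mulnC divnK //.
    have [/al//|] := boolP (v \in m).
    by rewrite -mset_eq0 => /eqP ->.
  rewrite (@fsbig_list _ _ _ _ _ [:: n]) //.
  - by rewrite big_seq1 /hpoly -mdegE -mE mdeg_mpow // eqn_pmul2l.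
  - by move=> n'; rewrite inE => /eqP ->.
  move=> n' /= n'E; rewrite inE => /eqP[]; apply/msetP => v.
  by rewrite nE -n'E mpowE mulKn.
rewrite (@fsbig_list _ _ _ _ _ [::]) ?big_nil // => n nE _.
by case: nal => v _; rewrite -nE mpowE dvdn_mulr.
Qed.

(** A variable of a monomial counted by [hset predT vdeg r d] occurs with exponent
    at least [r], so its degree is at most [d]. *)
Lemma hset_bounded K r d : (0 < r)%N -> (d <= K)%N ->
  hset predT vdeg r d = hset (fun v => v.1 < K)%N vdeg r d.
Proof.
move=> r0 dK; apply/funext => m; rewrite /hset.
case: (eqVneq (\sum_(v <- m) vdeg v)%N (r * d)%N) => [e|]; last by rewrite !andbF.
congr (nat_of_bool (_ && _))%:R; apply: eq_in_all => v vin /=.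
case: (boolP (r %| m v)%N) => rv; rewrite ?andbF // andbT; apply/esym.
have mv : (r <= m v)%N by apply: dvdn_leq rv; rewrite mset_gt0.
have : (vdeg v * m v <= r * d)%N.
  by rewrite -e -mdegE /mdeg (bigD1_seq v) ?fset_uniq ?msuppE //= leq_addr.
have : (r * vdeg v <= vdeg v * m v)%N by rewrite mulnC leq_mul2l mv orbT.
by move=> h1 h2; have := leq_trans h1 h2; rewrite leq_pmul2l // /vdeg; lia.
Qed.

Lemma schur_nil k : schur k [::] = 1.
Proof.
apply/funext => m; rewrite /schur (@fsbig_list _ _ _ _ _ [:: [::]]) //.
- rewrite big_seq1 -mono0 /mono eq_sym; congr (nat_of_bool (_ == _))%:R.
  by apply/msetP => v; rewrite mset_seqE mset0E.
- by move=> T; rewrite inE => /eqP ->.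
by move=> [|R T] // /andP[].
Qed.

Lemma polyribbon_sgn_refl r mu : (0 < r)%N -> is_part mu -> polyribbon_sgn r mu mu = 1.
Proof.
move=> r0 pm; have c : polyribbon_chain r mu mu [::].
  by rewrite /polyribbon_chain /= eqxx.
by rewrite (polyribbon_sgnE r0 pm c) big_nil.
Qed.

Lemma restr_bounded K tau k : all (fun b => b.1 <= K)%N tau -> (K < k)%N ->
  restr tau k = [::].
Proof.
move=> al Kk; rewrite /restr (_ : filter _ _ = [::]) //.
apply/eqP; rewrite -size_eq0 size_filter -leqn0 leqNgt -has_count.
by apply/hasPn => b /(allP al) /=; lia.
Qed.

Lemma prod_degrees (R : comNzRingType) K (f : nat -> R) :
  (forall k, (K < k)%N -> f k = 1) ->
  \big[*%R/1]_(k \in [set k | (0 < k)%N]) f k = \prod_(k < K) f k.+1.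
Proof.
move=> f1; rewrite (@fsbig_list _ _ _ _ _ (iota 1 K)) ?iota_uniq //.
- by rewrite (iotaDl 1 0) big_map -{1}[K]subn0 -/(index_iota 0 K) big_mkord.
- by move=> k; rewrite mem_iota => /andP[].
by move=> k /= k0; rewrite mem_iota => kK; apply: f1; lia.
Qed.

Lemma obtained_obtained_le d r sigma tau K : (0 < r)%N -> is_type sigma ->
  all (fun b => b.1 <= K)%N sigma -> (d <= K)%N ->
  obtained d r sigma tau <-> obtained_le r sigma K d tau.
Proof.
move=> r0 ts sK dK; split.
  move=> [tt [la [pla sla pol]]].
  have lad : all (fun p => p <= d)%N la.
    rewrite -sla; elim: (la) => //= a l IH; rewrite leq_addr /=.
    by apply: sub_all IH => p /=; lia.
  have cnt0 k : (d < k)%N -> count_mem k la = 0%N.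
    by move=> dk; apply/count_memPn/negP => /(allP lad) /=; lia.
  split=> //.
    apply/allP => b bt /=; rewrite leqNgt; apply/negP => Kb.
    have b0 := leq_ltn_trans (leq0n K) Kb.
    have := pol b.1 b0; rewrite cnt0; last exact: leq_ltn_trans dK Kb.
    move/polyribbon0_eq; rewrite (restr_bounded sK Kb) => e.
    have : b.2 \in restr tau b.1.
      by apply/mapP; exists b => //; rewrite mem_filter eqxx.
    by rewrite e.
  exists la; split=> //; first by apply: sub_all lad => p /=; lia.
  by move=> k /andP[k0 _]; exact: pol.
move=> [tt tK [la [pla laK sla pol]]]; split=> //; exists la; split=> // k k0.
have [kK|Kk] := leqP k K; first by apply: pol; rewrite k0.
rewrite (restr_bounded sK Kk) (restr_bounded tK Kk) (count_memPn _).
  exact: polyribbon0.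
by apply/negP => /(allP laK) /=; lia.
Qed.

Theorem theorem19 (sigma : seq (nat * nat)) (d r : nat)
    (hsigma : is_type sigma) (hblk : is_block (d, r)) :
  schur_tensor sigma * hblock d r =
  \sum_(tau \in [set tau | obtained d r sigma tau])
     sgn_tensor r sigma tau *: schur_tensor tau.
Proof.
have r0 : (0 < r)%N by case/andP: hblk.
(* beyond [K] every factor of the tensors is [1] *)
pose K := (d + \max_(b <- sigma) b.1)%N.
have dK : (d <= K)%N by exact: leq_addr.
have sK : all (fun b => b.1 <= K)%N sigma.
  apply/allP => b bs; apply: leq_trans (leq_addl _ _).
  exact: (leq_bigmax_seq (F := fst) b bs).
have schurE tau : all (fun b => b.1 <= K)%N tau ->
    schur_tensor tau = \prod_(k < K) schur k.+1 (restr tau k.+1).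
  move=> tK; rewrite /schur_tensor (@prod_degrees _ K) // => k Kk.
  by rewrite (restr_bounded tK Kk) schur_nil.
have obtP tau : obtained d r sigma tau <-> tau \in type_list r sigma K d.
  have eqv := obtained_obtained_le tau r0 hsigma sK dK.
  by split=> [/eqv/type_listP|/type_listP/eqv]; apply.
rewrite (@fsbig_list _ _ _ _ _ (type_list r sigma K d)); last first.
- by move=> tau /= /obtP ->.
- by move=> tau /obtP.
- exact: uniq_type_list.
rewrite schurE // hblock_hset // (hset_bounded r0 dK) schur_hset_degrees //.
rewrite big_seq [RHS]big_seq; apply: eq_bigr => tau.
move=> /(type_listP r0 hsigma)[tt tK _].
rewrite schurE //; congr (_ *: _).
rewrite /sgn_tensor (@prod_degrees _ K) // => k Kk.
by rewrite (restr_bounded sK Kk) (restr_bounded tK Kk) polyribbon_sgn_refl.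
Qed.
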